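(* Let $S=\{s_1,\dots,s_n\}$ be a dataset and $f(x)=\frac1n\sum_{i=1}^n f(x,s_i)$ on $\mathbb{R}^d$, where $f$ is differentiable with $G$-Lipschitz gradient, attains its minimum, and $D_f\ge f(x_1)-\min_x f(x)$ for a fixed initial point $x_1$. Let $c>0$, $\epsilon>0$, $\delta\in(0,1)$, $m\in\{1,\dots,n\}$. DP-SGD with gradient clipping performs $$x_{t+1}=x_t-\alpha\Big(\frac1m\sum_{i\in S_t}\mathrm{clip}(\nabla f(x_t)+\xi_{t,i},c)+Z_t\Big),\qquad t=1,\dots,T,$$ where $\xi_{t,i}=\nabla f(x_t,s_i)-\nabla f(x_t)$, $S_t$ is a random subsample of $S$ of size $m$ drawn with replacement, and $Z_t\sim\mathcal N(0,\sigma^2I)$ is independent noise. Let $p_t$ be the uniform (empirical) distribution on $\{\xi_{t,1},\dots,\xi_{t,n}\}$ and, for each $t$, let $\tilde p_t$ be any distribution on $\mathbb{R}^d$ symmetric under $\xi\mapsto-\xi$. Then there exist constants $u,v>0$ such that for any $\epsilon\le u\frac{m^2}{n^2}T$, with $\sigma^2=v\frac{c^2T\ln(1/\delta)}{n^2\epsilon^2}$, $\alpha=\frac{\sqrt{D_fd\ln(1/\delta)}}{n\epsilon c\sqrt G}$ and $T=\frac{n^2\epsilon^2}{d\ln(1/\delta)}$, $$\frac1T\sum_{t=1}^T\mathbb{E}\Big[\mathbb{P}_{\xi\sim\tilde p_t}\left(\|\xi\|<\frac c4\right)h_c(\|\nabla f(x_t)\|)\Big]\le\left(\frac12v+\frac32\right)c\frac{\sqrt{D_fGd\ln(1/\delta)}}{n\epsilon}+\frac1T\sum_{t=1}^T\mathbb{E}\big[W_{\nabla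 f(x_t),c}(\tilde p_t,p_t)\big].$$
   Context: For $g\in\mathbb{R}^d$ and $c>0$, $\mathrm{clip}(g,c)=g\cdot\min\left(1,\frac{c}{\|g\|}\right)$ (with $\mathrm{clip}(0,c)=0$). $G$-Lipschitz gradient means $\|\nabla f(x)-\nabla f(y)\|\le G\|x-y\|$. $h_c(y)=\min(y^2,\frac34cy)$. For $w\in\mathbb{R}^d$, $d_{w,c}(a,b)=|\langle w,\mathrm{clip}(w+a,c)\rangle-\langle w,\mathrm{clip}(w+b,c)\rangle|$, and $W_{w,c}(p,p')=\inf_{\gamma\in\Gamma(p,p')}\int\!\!\int d_{w,c}(a,b)\,d\gamma(a,b)$ is the Wasserstein distance with cost $d_{w,c}$, $\Gamma(p,p')$ the set of couplings with marginals $p,p'$. Expectations are over the randomness of the algorithm. *)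

(* Defs.v *)
From HB Require Import structures.
From mathcomp Require Import all_boot all_order all_algebra.
From mathcomp Require Import all_classical all_reals all_analysis.
From mathcomp Require Import measurable_realfun.
Set Implicit Arguments. Unset Strict Implicit. Unset Printing Implicit Defensive.
Import Order.TTheory GRing.Theory Num.Theory.
Import numFieldNormedType.Exports.
Local Open Scope classical_set_scope.
Local Open Scope ring_scope.

Section DPSGD.
Variables (R : realType) (d : nat).
Notation vec := 'rV[R]_d.

(* Euclidean inner product and Euclidean norm on R^d = 'rV_d
   (the library norm on matrices is the max-norm, so we define the
   Euclidean one explicitly). *)
Definition dotv (u v : vec) : R := \sum_(j < d) u 0 j * v 0 j.
Definition enorm (u : vec) : R := Num.sqrt (dotv u u).

Definition clip (g : vec) (c : R) : vec :=
  if g == 0 then 0 else Num.min 1 (c / enorm g) *: g.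

Definition hc (c y : R) : R := Num.min (y ^+ 2) (3 / 4 * c * y).

Definition dcost (w : vec) (c : R) (a b : vec) : R :=
  `| dotv w (clip (w + a) c) - dotv w (clip (w + b) c) |.

Definition grad (F : vec -> R) (x : vec) : vec :=
  \row_(j < d) ('d F x (delta_mx 0 j : vec)).

Definition BorelRd := g_sigma_algebraType (@open vec).

Definition symmetric_distr (p : set BorelRd -> \bar R) :=
  forall A : set BorelRd, measurable A ->
    p ((fun x : vec => - x) @^-1` A) = p A.

Definition coupling (p p' : set BorelRd -> \bar R)
    (g : probability (BorelRd * BorelRd)%type R) :=
  (forall A : set BorelRd, measurable A -> g (A `*` setT) = p A) /\
  (forall B : set BorelRd, measurable B -> g (setT `*` B) = p' B).

Definition wasserstein (w : vec) (c : R) (p p' : set BorelRd -> \bar R) : \bar R :=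
  ereal_inf [set (\int[g]_z (dcost w c z.1 z.2)%:E)%E
            | g in [set g | coupling p p' g]].

Definition empirical (n : nat) (xs : 'I_n -> vec) : set BorelRd -> \bar R :=
  fun A => (n%:R^-1 * \sum_(i < n) (\1_A (xs i) : R))%:E.

Definition favg (X : Type) (n : nat) (loss : vec -> X -> R) (s : 'I_n -> X)
  (x : vec) : R := n%:R^-1 * \sum_(i < n) loss x (s i).

Definition xi (X : Type) (n : nat) (loss : vec -> X -> R) (s : 'I_n -> X)
  (x : vec) (i : 'I_n) : vec :=
  grad (fun y => loss y (s i)) x - grad (favg loss s) x.

(* DP-SGD iterates, 0-indexed: dpsgd ... t w is the paper's x_{t+1}. *)
Fixpoint dpsgd (X : Type) (n m : nat) (loss : vec -> X -> R) (s : 'I_n -> X)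
  (c alpha : R) (x1 : vec) (Omega : Type)
  (idx : nat -> 'I_m -> Omega -> 'I_n) (Z : nat -> Omega -> vec)
  (t : nat) (w : Omega) : vec :=
  match t with
  | 0 => x1
  | t'.+1 =>
    let xt := dpsgd loss s c alpha x1 idx Z t' w in
    xt - alpha *: (m%:R^-1 *: (\sum_(k < m)
            clip (grad (favg loss s) xt + xi loss s xt (idx t' k w)) c)
          + Z t' w)
  end.

Definition rv_events (dO : measure_display) (Omega : measurableType dO)
  (n m T : nat) (idx : nat -> 'I_m -> Omega -> 'I_n) (Z : nat -> Omega -> vec)
  (k : ('I_T * 'I_m + 'I_T * 'I_d)%type) : set (set Omega) :=
  match k with
  | inl (t, i) => [set idx t i @^-1` B | B in [set: set 'I_n]]
  | inr (t, j) => [set (fun w => Z t w 0 j) @^-1` B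
                  | B in [set B : set R | measurable B]]
  end.

Definition mutually_independent (dO : measure_display) (Omega : measurableType dO)
  (P : probability Omega R) (K : finType) (E : K -> set (set Omega)) :=
  forall (J : {set K}) (A : K -> set Omega),
    (forall k, k \in J -> E k (A k)) ->
    P (\bigcap_(k in [set k | k \in J]) A k) = (\prod_(k in J) P (A k))%E.

End DPSGD.

(* Main.v *)
(* With u = v = 1 the parameters give d sigma^2 = c^2.  Write x_t for the
   iterates, g_t for the average of the clipped gradients, and
   phi(x) = (1/n) sum_i <grad f(x), clip(grad f(x) + xi_i, c)>.  Smoothness gives
     f(x_{t+1}) <= f(x_t) - alpha <grad f(x_t), g_t + Z_t>
                   + (G alpha^2 / 2) |g_t + Z_t|^2.
   In expectation, sampling turns <grad f(x_t), g_t> into phi(x_t), the terms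
   linear in Z_t vanish, |g_t|^2 <= c^2 and E |Z_t|^2 <= d sigma^2; telescoping
   bounds the average of E phi(x_t).
   On the other side, a distribution p symmetric about 0 satisfies
     P(|xi| < c/4) h_c(|w|) <= E_p <w, clip(w + xi, c)>
   by pairing xi with - xi, and replacing p by the empirical distribution costs at
   most the Wasserstein distance, so the left-hand side at time t is at most
   phi(x_t) + W. *)
Require Import Defs.
From HB Require Import structures.
From mathcomp Require Import all_boot all_order all_algebra.
From mathcomp Require Import all_classical all_reals all_analysis.
From mathcomp Require Import measurable_realfun.
From mathcomp Require Import ring lra.
Set Implicit Arguments. Unset Strict Implicit. Unset Printing Implicit Defensive.
Import Order.TTheory GRing.Theory Num.Theory.
Import numFieldNormedType.Exports.
Local Open Scope classical_set_scope.
Local Open Scope ring_scope.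

(** * Euclidean geometry and clipping *)

(** Gaussian steps make the iterates unbounded, so no expectation in the descent argument is
    available for free. Clipping keeps [g_t] in the ball of radius [c], hence the second moment of
    [x_t] stays finite by induction on [t], and the Lipschitz gradient passes this on to the
    gradient and the objective. Conditional expectations are replaced by one orthogonality
    statement: [E[U V] = 0] when [U] is measurable for the past and [V] is centred and independent
    of it. The noise is the case where [V] is a coordinate of [Z_t]; sampling is the case where [V]
    is the indicator of [idx t k = i] minus [1/n]. In the comparison of the symmetric and the
    empirical distribution, the inner product is shifted by [|w| c], which makes it nonnegative;
    integrals then add and transport along couplings with no integrability to check. *)

Section EuclideanSpace.
Context {R : realType} {d : nat}.
Implicit Types (u v w : 'rV[R]_d) (a c : R).

Lemma dotvC u v : dotv u v = dotv v u.
Proof. by apply: eq_bigr => j _; rewrite mulrC. Qed.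

Lemma dotvDl u v w : dotv (u + v) w = dotv u w + dotv v w.
Proof. by rewrite -big_split; apply: eq_bigr => j _; rewrite mxE mulrDl. Qed.

Lemma dotvDr u v w : dotv w (u + v) = dotv w u + dotv w v.
Proof. by rewrite dotvC dotvDl !(dotvC w). Qed.

Lemma dotvZl a u v : dotv (a *: u) v = a * dotv u v.
Proof. by rewrite mulr_sumr; apply: eq_bigr => j _; rewrite mxE mulrA. Qed.

Lemma dotvZr a u v : dotv u (a *: v) = a * dotv u v.
Proof. by rewrite dotvC dotvZl dotvC. Qed.

Lemma dotvNl u v : dotv (- u) v = - dotv u v.
Proof. by rewrite -scaleN1r dotvZl mulN1r. Qed.

Lemma dotvNr u v : dotv u (- v) = - dotv u v.
Proof. by rewrite dotvC dotvNl dotvC. Qed.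

Lemma dotv0r u : dotv u 0 = 0.
Proof. by rewrite -(scale0r 0) dotvZr mul0r. Qed.

Lemma dotv_sumr (I : Type) (s : seq I) (F : I -> 'rV[R]_d) u :
  dotv u (\sum_(i <- s) F i) = \sum_(i <- s) dotv u (F i).
Proof.
elim/big_rec2: _ => [|i y x _ <-]; first exact: dotv0r.
by rewrite dotvDr.
Qed.

Lemma dotv_ge0 u : 0 <= dotv u u.
Proof. by apply: sumr_ge0 => j _; rewrite -expr2 sqr_ge0. Qed.

Lemma dotv_eq0 u : (dotv u u == 0) = (u == 0).
Proof.
apply/eqP/eqP => [u0|->]; last exact: dotv0r.
apply/rowP => j; rewrite mxE; apply/eqP; rewrite -sqrf_eq0 expr2.
by apply/eqP/(psumr_eq0P _ u0) => // i _; rewrite -expr2 sqr_ge0.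
Qed.

Lemma sqr_coord_le_dotv u j : u 0 j ^+ 2 <= dotv u u.
Proof.
rewrite /dotv (bigD1 j)//= -expr2 lerDl.
by apply: sumr_ge0 => i _; rewrite -expr2 sqr_ge0.
Qed.

Lemma enorm_ge0 u : 0 <= enorm u.
Proof. exact: sqrtr_ge0. Qed.

Lemma sqr_enorm u : enorm u ^+ 2 = dotv u u.
Proof. by rewrite sqr_sqrtr ?dotv_ge0. Qed.

Lemma enorm_gt0 u : u != 0 -> 0 < enorm u.
Proof. by move=> u0; rewrite sqrtr_gt0 lt_def dotv_eq0 u0 dotv_ge0. Qed.

Lemma enorm0 : enorm (0 : 'rV[R]_d) = 0.
Proof. by rewrite /enorm dotv0r sqrtr0. Qed.

Lemma enormN u : enorm (- u) = enorm u.
Proof. by rewrite /enorm dotvNl dotvNr opprK. Qed.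

Lemma cauchy_schwarz_sqr u v : dotv u v ^+ 2 <= dotv u u * dotv v v.
Proof.
have [->|v0] := eqVneq v 0; first by rewrite !dotv0r expr0n mulr0.
have vv : 0 < dotv v v by rewrite lt_def dotv_eq0 v0 dotv_ge0.
have := dotv_ge0 (dotv v v *: u - dotv u v *: v).
rewrite dotvDl !dotvDr !dotvNl !dotvNr !dotvZl !dotvZr (dotvC v u).
set p := dotv u u; set q := dotv u v; set r := dotv v v in vv *.
have -> : r * (r * p) - r * (q * q) + (- (q * (r * q)) - - (q * (q * r))) =
  r * (p * r - q ^+ 2) by ring.
by rewrite pmulr_rge0// subr_ge0.
Qed.

Lemma cauchy_schwarz u v : `|dotv u v| <= enorm u * enorm v.
Proof.
rewrite -sqrtrM ?dotv_ge0// -sqrtr_sqr ler_sqrt ?cauchy_schwarz_sqr//.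
by rewrite mulr_ge0 ?dotv_ge0.
Qed.

Lemma dotv_double_le u v : 2 * dotv u v <= dotv u u + dotv v v.
Proof.
have := dotv_ge0 (u - v).
rewrite !dotvDl !dotvDr !dotvNl !dotvNr (dotvC v u); lra.
Qed.

Lemma dotv_sqrD_le u v : dotv (u + v) (u + v) <= 2 * dotv u u + 2 * dotv v v.
Proof.
have := dotv_double_le u v.
rewrite !dotvDl !dotvDr (dotvC v u); lra.
Qed.

(* Also correct at [u = 0], where [c / 0 = 0] makes the factor vanish. *)
Lemma clipE u c : clip u c = Num.min 1 (c / enorm u) *: u.
Proof. by rewrite /clip; case: eqP => // ->; rewrite scaler0. Qed.

Lemma clip_factor u c : 0 < c -> u != 0 ->
  Num.min 1 (c / enorm u) = c / Num.max c (enorm u).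
Proof.
move=> c0 u0; have eu := enorm_gt0 u0.
by case: (leP c (enorm u)) => h; [apply/min_idPr|rewrite divff ?gt_eqF//; apply/min_idPl];
  rewrite ?ler_pdivrMr ?ler_pdivlMr ?mul1r// ltW.
Qed.

(** The denominator is at least [c > 0], so in this form the factor is a continuous function of the
    norm, at [u = 0] included. Both the inequalities and the measurability of clipping rest on
    it. *)
Lemma clipE_max u c : 0 < c -> clip u c = (c / Num.max c (enorm u)) *: u.
Proof.
move=> c0; rewrite clipE; have [->|u0] := eqVneq u 0; first by rewrite !scaler0.
by rewrite clip_factor.
Qed.

Lemma enorm_clip_sqr_le u c : 0 < c -> dotv (clip u c) (clip u c) <= c ^+ 2.
Proof.
move=> c0; rewrite clipE_max// dotvZl dotvZr -sqr_enorm mulrA -expr2 -exprMn.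
set m := Num.max _ _.
have m0 : 0 < m by rewrite lt_max c0.
have := enorm_ge0 u => u0.
rewrite ler_sqr ?nnegrE ?mulr_ge0 ?invr_ge0 ?(ltW c0) ?(ltW m0)//.
by rewrite mulrAC ler_pdivrMr// ler_pM2l// le_max lexx orbT.
Qed.

Lemma dotv_clip_le w u c : 0 < c -> `|dotv w (clip u c)| <= enorm w * c.
Proof.
move=> c0; apply: le_trans (cauchy_schwarz _ _) _.
rewrite ler_wpM2l ?enorm_ge0// -ler_sqr ?nnegrE ?enorm_ge0 ?(ltW c0)//.
by rewrite sqr_enorm enorm_clip_sqr_le.
Qed.

Lemma hc_ge0 c y : 0 <= c -> 0 <= y -> 0 <= hc c y.
Proof. by move=> c0 y0; rewrite le_min sqr_ge0/= !mulr_ge0. Qed.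

(** By symmetry [<w, e> >= 0], so only the [w - e] term can be negative, and only if [q > |w|^2].
    Then [w + e] makes a smaller angle with [w] than [e - w] does, so its positive contribution
    wins. *)
Lemma clip_sym_ge0 w e c : 0 < c ->
  0 <= dotv w (clip (w + e) c) + dotv w (clip (w - e) c).
Proof.
move=> c0.
wlog q0 : e / 0 <= dotv w e.
  move=> h; have [|qn] := leP 0 (dotv w e); first exact: h.
  by have := h (- e); rewrite opprK addrC; apply; rewrite dotvNr oppr_ge0 ltW.
rewrite !clipE_max// !dotvZr !dotvDr dotvNr -!sqr_enorm.
set y2 := enorm w ^+ 2; set q := dotv w e in q0 *.
have y20 : 0 <= y2 by rewrite sqr_ge0.
set N := enorm (w + e); set M := enorm (w - e).
have N0 : 0 <= N := enorm_ge0 _.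
have M0 : 0 <= M := enorm_ge0 _.
have N2 : N ^+ 2 = y2 + 2 * q + dotv e e.
  by rewrite sqr_enorm !dotvDl !dotvDr (dotvC e) /y2 sqr_enorm -/q; ring.
have M2 : M ^+ 2 = y2 - 2 * q + dotv e e.
  rewrite sqr_enorm !dotvDl !dotvDr !dotvNl !dotvNr (dotvC e) /y2 sqr_enorm -/q.
  by ring.
have CS : q ^+ 2 <= y2 * dotv e e by rewrite /y2 sqr_enorm cauchy_schwarz_sqr.
have r0 := dotv_ge0 e; set r := dotv e e in r0 N2 M2 CS *.
have mN : 0 < Num.max c N by rewrite lt_max c0.
have mM : 0 < Num.max c M by rewrite lt_max c0.
rewrite -!mulrA -mulrDr pmulr_rge0//.
have [yq|qy] := leP q y2.
  by rewrite addr_ge0// mulr_ge0 ?invr_ge0 ?(ltW mN) ?(ltW mM)//; lra.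
have -> : (Num.max c N)^-1 * (y2 + q) + (Num.max c M)^-1 * (y2 - q) =
  (Num.max c M * (y2 + q) - Num.max c N * (q - y2)) / (Num.max c N * Num.max c M).
  by field; rewrite !gt_eqF.
rewrite divr_ge0 ?mulr_ge0 ?(ltW mN) ?(ltW mM)//.
(* [H] compares the cosines of [w + e] and [e - w] with [w], which settles the case where both
   vectors are clipped. The other cases follow from it or from [M <= N]; squared, it is
   Cauchy-Schwarz. *)
suff H : N * (q - y2) <= M * (y2 + q).
  case: (leP c N) => cN; case: (leP c M) => cM; rewrite subr_ge0.
  - exact: H.
  - by apply: (le_trans H); rewrite ler_wpM2r// ?ltW//; lra.
  - have : M <= N by rewrite -ler_sqr ?nnegrE// N2 M2 lerD2r; lra.
    lra.
  - by rewrite ler_pM2l//; lra.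
rewrite -ler_sqr ?nnegrE; [|by rewrite mulr_ge0//; lra..].
rewrite !exprMn N2 M2 -subr_ge0.
have -> : (y2 - 2 * q + r) * (y2 + q) ^+ 2 - (y2 + 2 * q + r) * (q - y2) ^+ 2
   = 4 * q * (y2 * r - q ^+ 2) by ring.
by rewrite mulr_ge0 ?subr_ge0//; lra.
Qed.

(** Here [x / N] is the cosine of a vector of length [N] whose orthogonal part has squared length
    [z c^2]. As [c <= N], [x^2 >= (1 - z) N^2 >= (1 - z)^2 N^2]; the second, lossy step gives a
    bound linear in [z]. *)
Lemma cos_lower_bound c x N z : 0 < c -> c <= N -> 0 <= x -> 0 <= z <= 1 ->
  N ^+ 2 = x ^+ 2 + z * c ^+ 2 -> 1 - z <= x / N.
Proof.
move=> c0 cN x0 /andP[z0 z1] N2; have N0 : 0 < N := lt_le_trans c0 cN.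
rewrite ler_pdivlMr// -ler_sqr ?nnegrE ?mulr_ge0 ?subr_ge0 ?(ltW N0)//.
have -> : x ^+ 2 = N ^+ 2 - z * c ^+ 2 by rewrite N2 addrK.
have cN2 : c ^+ 2 <= N ^+ 2 by rewrite ler_sqr ?nnegrE ?(ltW c0) ?(ltW N0).
rewrite -subr_ge0.
have -> : N ^+ 2 - z * c ^+ 2 - ((1 - z) * N) ^+ 2 =
  z * (N ^+ 2 - c ^+ 2) + z * (1 - z) * N ^+ 2 by ring.
by rewrite addr_ge0// mulr_ge0 ?sqr_ge0 ?subr_ge0// mulr_ge0 ?subr_ge0.
Qed.

(* The critical case is [c < |w + e|], where [|w| > 3c/4].  With [e] of component
   [p] along [w], [w + e] has cosine at least [1 - z] with [w], where
   [z c^2 = |e|^2 - p^2]; if [w - e] is not clipped the claim reduces to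
   [(p - c/4) (p - 3c/4) >= 0]. *)
Lemma clip_sym_ge_hc w e c : 0 < c -> enorm e < c / 4 ->
  2 * hc c (enorm w) <= dotv w (clip (w + e) c) + dotv w (clip (w - e) c).
Proof.
move=> c0 ec; have r0 := enorm_ge0 e; have y0 := enorm_ge0 w.
wlog q0 : e ec r0 / 0 <= dotv w e.
  move=> h; have [|qn] := leP 0 (dotv w e); first exact: h.
  have := h (- e); rewrite opprK addrC; apply; rewrite ?enormN//.
  by rewrite dotvNr oppr_ge0 ltW.
have [w0|w0] := eqVneq w 0.
  apply: le_trans (clip_sym_ge0 _ _ c0).
  by rewrite w0 enorm0 /hc expr0n mulr0 minxx mulr0.
have {w0 y0} y0 := enorm_gt0 w0.
rewrite !clipE_max// !dotvZr !dotvDr dotvNr -!sqr_enorm.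
set N := enorm (w + e); set M := enorm (w - e).
have N0 : 0 <= N := enorm_ge0 _.
have M0 : 0 <= M := enorm_ge0 _.
have qyr := cauchy_schwarz w e.
have [p qE] : exists p, dotv w e = enorm w * p.
  by exists (dotv w e / enorm w); rewrite mulrC divfK ?gt_eqF.
have N2 : N ^+ 2 = enorm w ^+ 2 + 2 * dotv w e + enorm e ^+ 2.
  by rewrite !sqr_enorm !dotvDl !dotvDr (dotvC e); ring.
have M2 : M ^+ 2 = enorm w ^+ 2 - 2 * dotv w e + enorm e ^+ 2.
  by rewrite !sqr_enorm !dotvDl !dotvDr !dotvNl !dotvNr (dotvC e); ring.
rewrite ger0_norm// qE ler_pM2l// in qyr; rewrite qE pmulr_rge0// in q0.
rewrite qE in N2 M2 *; clear qE.
move: (enorm w) (enorm e) p N M y0 ec r0 q0 qyr N0 M0 N2 M2 => y r p N M.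
move=> y0 ec r0 p0 pr N0 M0 N2 M2.
have MN : M <= N.
  by rewrite -ler_sqr ?nnegrE// N2 M2; have := mulr_ge0 (ltW y0) p0; lra.
(* [w + e] is the longer vector: if it is not clipped, neither is [w - e], and the sum is exactly
   [2 |w|^2]. *)
have [Nc|cN] := leP N c.
  rewrite (max_idPl (le_trans MN Nc)) divff ?gt_eqF//.
  suff : hc c y <= y ^+ 2 by lra.
  by rewrite ge_min lexx.
(* The factor [3/4] of [hc] and the radius [c / 4] belong together: [c < |w + e| <= |w| + |e|] and
   [|e| < c / 4]. *)
have cy : 3 / 4 * c < y.
  have : c ^+ 2 < (y + r) ^+ 2.
    apply: (@lt_le_trans _ _ (N ^+ 2)); first by rewrite ltr_sqr ?nnegrE// ltW.
    by rewrite N2; have := ler_wpM2l (ltW y0) pr; lra.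
  by rewrite ltr_sqr ?nnegrE ?(ltW c0) ?addr_ge0 ?(ltW y0)//; lra.
have hcy : hc c y <= 3 / 4 * c * y by rewrite ge_min lexx orbT.
pose z := (r ^+ 2 - p ^+ 2) / c ^+ 2.
have zc : z * c ^+ 2 = r ^+ 2 - p ^+ 2 by rewrite divfK// expf_neq0// gt_eqF.
have r2 : r ^+ 2 <= (c / 4) ^+ 2 by rewrite ler_sqr ?nnegrE; lra.
have c20 : 0 < c ^+ 2 by rewrite exprn_gt0.
have z01 : 0 <= z <= 1.
  rewrite divr_ge0 ?subr_ge0 ?ler_sqr ?nnegrE ?(ltW c20)//=.
  by rewrite ler_pdivrMr// mul1r; have := sqr_ge0 p; lra.
have zp : z <= 1 / 16 - (p / c) ^+ 2.
  have : z <= (c ^+ 2 / 16 - p ^+ 2) / c ^+ 2 by rewrite ler_pM2r ?invr_gt0//; lra.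
  congr (_ <= _); field; exact: lt0r_neq0.
have NN : N ^+ 2 = (y + p) ^+ 2 + z * c ^+ 2 by rewrite zc N2; ring.
have MM : M ^+ 2 = (y - p) ^+ 2 + z * c ^+ 2 by rewrite zc M2; ring.
have cosN : 1 - z <= (y + p) / N.
  by apply: (cos_lower_bound c0) => //; [exact: ltW|lra].
have pc0 := sqr_ge0 (p / c).
(* This is the claim divided by [y]. Since [z <= 1/16], each clipped vector contributes at least
   [15 c / 16]; an unclipped [w - e] contributes [y - p] with [y > 3 c / 4]. *)
suff : 3 / 2 * c <= c * ((y + p) / N) + c / Num.max c M * (y - p).
  rewrite -(ler_pM2l y0).
  have -> : y * (c * ((y + p) / N) + c / Num.max c M * (y - p)) =
    c / N * (y ^+ 2 + y * p) + c / Num.max c M * (y ^+ 2 - y * p) by ring.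
  lra.
have cN' : c * (1 - z) <= c * ((y + p) / N) by rewrite ler_pM2l.
have [Mc|cM] := leP M c.
  rewrite divff ?gt_eqF// mul1r.
  have : 0 <= (p - c / 4) * (p - 3 / 4 * c) / c.
    by rewrite mulr_ge0 ?invr_ge0 ?(ltW c0)// mulr_le0//; lra.
  have -> : (p - c / 4) * (p - 3 / 4 * c) / c = c * ((p / c) ^+ 2) - p + 3 / 16 * c.
    by field; exact: lt0r_neq0.
  have := ler_wpM2l (ltW c0) zp; lra.
have cosM : 1 - z <= (y - p) / M.
  by apply: (cos_lower_bound c0) => //; [exact: ltW|lra].
have cM' : c * (1 - z) <= c / M * (y - p) by rewrite mulrAC -mulrA ler_pM2l.
have := ler_wpM2l (ltW c0) zp; have := mulr_ge0 (ltW c0) pc0; lra.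
Qed.

End EuclideanSpace.

(** * Moments of the centred normal distribution *)

Section NormalMoments.
Context {R : realType} (sigma : R).
Hypothesis sigma0 : sigma != 0.
Notation mu := (@lebesgue_measure R).
Notation N := (normal_prob 0 sigma).
Notation pdf := (normal_pdf 0 sigma).

Lemma normal_pdfN x : pdf (- x) = pdf x.
Proof. by rewrite !normal_pdfE// /normal_fun !subr0 sqrrN. Qed.

(** Change of variables holds for the Radon-Nikodym derivative of [N], and [pdf] equals that
    derivative almost everywhere because both integrate to [N E] over every measurable [E]. *)
Lemma ge0_integral_normal (f : R -> \bar R) : measurable_fun setT f ->
  (forall x, 0 <= f x)%E ->
  (\int[N]_x f x = \int[mu]_x (f x * (pdf x)%:E))%E.
Proof.
move=> mf f0; have dom := normal_prob_dominates 0 sigma.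
rewrite -(Radon_Nikodym_SigmaFinite.change_of_variables dom f0 measurableT mf).
have fi := Radon_Nikodym_SigmaFinite.f_integrable dom.
have mpdf : measurable_fun setT (fun x => (pdf x)%:E).
  by apply/measurable_EFinP; exact: measurable_normal_pdf.
apply: ae_eq_integral => //.
- by apply: emeasurable_funM => //; exact: measurable_int fi.
- exact: emeasurable_funM.
- apply: ae_eqe_mul2l; apply: integral_ae_eq => // E _ mE.
  by rewrite -(Radon_Nikodym_SigmaFinite.f_integral dom).
Qed.

Lemma normal_probN (A : set R) : measurable A -> N (-%R @^-1` A) = N A.
Proof.
move=> mA; rewrite [in RHS]/normal_prob.
rewrite (@eq_measure_integral _ _ _ _
  (pushforward mu (-%R : R -> measurableTypeR R))); last first.
  by move=> B mB _; apply/esym; exact: lebesgue_measureN.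
rewrite ge0_integral_pushforward//.
- by apply: eq_integral => x _ /=; rewrite normal_pdfN.
- by apply/measurable_funTS/measurable_EFinP; exact: measurable_normal_pdf.
- by move=> x _; rewrite lee_fin normal_pdf_ge0.
Qed.

(* [x^2 pdf - sigma^2 pdf] is the derivative of [- sigma^2 x pdf], whose increment
   over a symmetric interval is nonpositive. *)
Lemma integral_sqr_normal_le : (\int[N]_x (x ^+ 2)%:E <= (sigma ^+ 2)%:E)%E.
Proof.
have msq : measurable_fun setT (fun x : R => (x ^+ 2)%:E).
  by apply/measurable_EFinP; exact: exprn_measurable.
rewrite ge0_integral_normal//; last by move=> x; rewrite lee_fin sqr_ge0.
have mpdf := measurable_normal_pdf 0 sigma.
pose h x := (x ^+ 2 * pdf x)%:E.
have mh : measurable_fun setT h.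
  by apply/measurable_EFinP/measurable_funM => //; exact: exprn_measurable.
have h0 x : (0 <= h x)%E by rewrite lee_fin mulr_ge0 ?sqr_ge0 ?normal_pdf_ge0.
rewrite (_ : (\int[mu]_x _ = \int[mu]_x h x)%E); last first.
  by apply: eq_integral => x _; rewrite EFinM.
(* Monotone convergence along these intervals reduces the claim to a bound uniform in [n]. The index
   [n.+1] keeps the interval nondegenerate, as the fundamental theorem of calculus requires. *)
pose F n : set R := `[- n.+1%:R, n.+1%:R]%classic.
have FT : \bigcup_n F n = setT.
  apply/seteqP; split => // x _.
  exists (Num.bound `|x|) => //; rewrite /F/= in_itv/= -ler_norml.
  apply: ltW; apply: lt_le_trans (archi_boundP (normr_ge0 x)) _.
  by rewrite ler_nat.
have ndF : nondecreasing_seq F.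
  by move=> a b ab; apply/subsetPset; apply: subset_itv; rewrite bnd_simp ?lerN2 ler_nat.
have cF := @ge0_nondecreasing_set_cvg_integral _ (measurableTypeR R) R F h mu ndF
  (fun=> measurable_itv _) (fun=> measurable_funTS mh) (fun _ x _ => h0 x).
rewrite FT in cF; apply: (cvge_le _ cF) => //; apply: nearW => n.
have n0 : - n.+1%:R < n.+1%:R :> R.
  by apply: (@lt_trans _ _ 0); rewrite ?oppr_lt0 ltr0n.
pose Fn (x : R) : R := - sigma ^+ 2 * (x * pdf x).
have dpdf (x : R) : is_derive x (1 : R) (pdf : R -> R) (- (x / sigma ^+ 2) * pdf x).
  pose g (t : R) : R := - (sigma ^+ 2 *+ 2)^-1 * t ^+ 2.
  have dg : is_derive x (1 : R) g (- (sigma ^+ 2 *+ 2)^-1 * (2 * x)).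
    have := @is_deriveZ R R^o R^o (fun t : R => t ^+ 2) (- (sigma ^+ 2 *+ 2)^-1) x 1 (2 * x).
    apply; have := @is_deriveX R R^o id 2 x 1 _ (is_derive_id _ _).
    by rewrite /GRing.scale/= expr1 mulr1.
  have -> : (pdf : R -> R) = (fun t => normal_peak sigma * (expR \o g) t).
    apply/funext => t; rewrite normal_pdfE// /normal_fun subr0 /=; congr (_ * expR _).
    by rewrite /g !mulNr mulrC.
  have := @is_deriveZ R R^o R^o _ (normal_peak sigma) x 1 _
    (is_derive1_comp (is_derive_expR (g x)) dg).
  move=> /is_derive_eq; apply; rewrite /GRing.scale/=; field.
  by [].
have dF (x : R) : is_derive x (1 : R) (Fn : R -> R) (x ^+ 2 * pdf x - sigma ^+ 2 * pdf x).
  have := @is_deriveM R R^o _ _ x 1 _ _ (is_derive_id x 1) (dpdf x).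
  move=> /(@is_deriveZ R R^o R^o _ (- sigma ^+ 2)); move=> /is_derive_eq; apply.
  by rewrite /GRing.scale/=; field.
have cpdf : continuous (pdf : R -> R) := continuous_normal_pdf sigma0.
pose f x := x ^+ 2 * pdf x - sigma ^+ 2 * pdf x.
have cf : continuous (f : R -> R).
  move=> x; apply: (@cvgB _ R^o); apply: cvgM; try exact: cpdf.
    exact: sqr_continuous.
  exact: cvg_cst.
have := @continuous_FTC2 R f Fn _ _ n0.
have -> : ((Fn n.+1%:R)%:E - (Fn (- n.+1%:R))%:E)%E =
    (- (2 * sigma ^+ 2 * n.+1%:R * pdf n.+1%:R))%:E :> \bar R.
  by rewrite -EFinB /Fn normal_pdfN; congr EFin; ring.
move=> /(_ (continuous_subspaceT cf)) FTC.
have {}FTC : (\int[mu]_(x in F n) (f x)%:E <= 0)%E.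
  rewrite FTC.
  - by rewrite lee_fin oppr_le0 mulr_ge0 ?normal_pdf_ge0// mulr_ge0// mulr_ge0// sqr_ge0.
  - split => [x _|| ].
    + exact: (@ex_derive _ R^o R^o).
    + apply: cvg_at_right_filter; apply: differentiable_continuous.
      exact/derivable1_diffP/(@ex_derive _ R^o R^o).
    + apply: cvg_at_left_filter; apply: differentiable_continuous.
      exact/derivable1_diffP/(@ex_derive _ R^o R^o).
  - by move=> x _; rewrite derive1E derive_val.
have ipdf : mu.-integrable (F n) (fun x => (pdf x)%:E).
  apply: (integrableS measurableT _ _ (integrable_normal_pdf 0 sigma)) => //.
  exact: measurable_itv.
rewrite (_ : (\int[mu]_(x in F n) h x)%E =
    (\int[mu]_(x in F n) ((f x)%:E + (sigma ^+ 2)%:E * (pdf x)%:E))%E); last first.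
  by apply: eq_integral => x _; rewrite -EFinM -EFinD subrK.
rewrite integralD//; last 2 first.
- apply: continuous_compact_integrable; first exact: segment_compact.
  exact: continuous_subspaceT.
- by apply: integrableZl => //; exact: measurable_itv.
rewrite -[X in (_ <= X)%E]add0e leeD// integralZl//; last exact: measurable_itv.
rewrite -[X in (_ <= X)%E]mule1 lee_wpmul2l ?lee_fin ?sqr_ge0//.
by apply: (@probability_le1 _ _ _ N (F n)); exact: measurable_itv.
exact: measurable_itv.
Qed.

Context {dO : measure_display} {Omega : measurableType dO}.
Variables (P : probability Omega R) (V : Omega -> R).
Hypothesis mV : measurable_fun setT V.
Hypothesis PV : forall B : set R, measurable B -> P (V @^-1` B) = N B.

Lemma integral_sqr_gaussian_le : (\int[P]_w (V w ^+ 2)%:E <= (sigma ^+ 2)%:E)%E.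
Proof.
apply: le_trans integral_sqr_normal_le.
rewrite (@eq_measure_integral _ _ _ _
  (pushforward P (V : Omega -> measurableTypeR R))); last first.
  by move=> B mB _; apply/esym; exact: PV.
rewrite ge0_integral_pushforward//.
- by apply/measurable_EFinP; exact: exprn_measurable.
- by move=> x _; rewrite lee_fin sqr_ge0.
Qed.

Lemma integrable_sqr_gaussian : P.-integrable setT (fun w => (V w ^+ 2)%:E).
Proof.
apply/integrableP; split; first by apply/measurable_EFinP/measurable_funX.
rewrite (eq_integral (fun w => (V w ^+ 2)%:E)); last first.
  by move=> w _; rewrite gee0_abs// lee_fin sqr_ge0.
exact: le_lt_trans integral_sqr_gaussian_le (ltry _).
Qed.

Lemma integrable_gaussian : P.-integrable setT (EFin \o V).
Proof.
apply: (@le_integrable _ _ _ P setT measurableT _ (fun w => (1%:E + (V w ^+ 2)%:E)%E)).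
- exact/measurable_EFinP.
- move=> w _; rewrite -EFinD [abse]lock /= -lock lee_fin [leRHS]ger0_norm ?addr_ge0 ?sqr_ge0//.
  rewrite -(real_normK (num_real (V w))); have := sqr_ge0 (`|V w| - 1).
  have := normr_ge0 (V w); nra.
- apply: integrableD => //; last exact: integrable_sqr_gaussian.
  exact: finite_measure_integrable_cst.
Qed.

(** [V] and [- V] have the same law, so the integral equals its own opposite; being finite, it is
    zero. *)
Lemma integral_gaussian : (\int[P]_w (V w)%:E = 0)%E.
Proof.
have iV := integrable_gaussian.
pose V' w := - V w.
have mN : measurable_fun setT V' by exact: measurable_funN.
have iN : P.-integrable setT (EFin \o V').
  by apply: eq_integrable (integrableN iV) => // w _.
have e : (\int[P]_w (V w)%:E = \int[P]_w (V' w)%:E)%E.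
  transitivity (\int[pushforward P (V : Omega -> measurableTypeR R)]_x x%:E)%E.
    by rewrite integral_pushforward//; exact: EFin_measurable.
  transitivity (\int[pushforward P (V' : Omega -> measurableTypeR R)]_x x%:E)%E; last first.
    by rewrite integral_pushforward//; exact: EFin_measurable.
  apply: eq_measure_integral => B mB _.
  have mNB : measurable (-%R @^-1` B : set R).
    by rewrite -[X in measurable X]setTI; exact: oppr_measurable.
  exact: (etrans (PV mB) (etrans (esym (normal_probN mB)) (esym (PV mNB)))).
move: e; rewrite (_ : (\int[P]_w (V' w)%:E)%E = (- \int[P]_w (V w)%:E)%E); last first.
  by rewrite -integralN//; exact: integrable_add_def.
have : (\int[P]_w (V w)%:E)%E \is a fin_num by exact: integrable_fin_num.
move: (\int[P]_w (V w)%:E)%E => [r| |]//= _ [] h; congr EFin; lra.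
Qed.

End NormalMoments.

(** * Orthogonality from independence *)

Section Orthogonality.
Context {dO : measure_display} {Omega : measurableType dO} {R : realType}.
Variable P : probability Omega R.
Import HBNNSimple.

Lemma integral_mul_indic (A : set Omega) (V : Omega -> R) :
  (\int[P]_(x in A) (V x)%:E = \int[P]_x (\1_A x * V x)%:E)%E.
Proof.
rewrite integral_mkcond; apply: eq_integral => w _.
by rewrite patchE indicE; case: ifP => _; rewrite ?mul1r ?mul0r.
Qed.

Lemma integrable_mul_indic (A : set Omega) (V : Omega -> R) : measurable A ->
  P.-integrable setT (EFin \o V) ->
  P.-integrable setT (fun w => (\1_A w * V w)%:E).
Proof.
move=> mA iV; have := integrableS measurableT mA (@subsetT _ _) iV.
rewrite integrable_mkcond//; apply: eq_integrable => // w _ /=.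
by rewrite patchE indicE; case: ifP => _ /=; rewrite ?mul1r ?mul0r.
Qed.

(** The hypothesis on [V] says that its conditional expectation given [<<s G>>] is zero. It passes
    from indicators to simple functions by linearity, and to [U] by dominated convergence. *)
Lemma integral_sub_sigma_mul_eq0 (G : set (set Omega)) (U V : Omega -> R) :
  <<s G >> `<=` measurable ->
  P.-integrable setT (EFin \o V) ->
  (forall A, <<s G >> A -> (\int[P]_(x in A) (V x)%:E = 0)%E) ->
  measurable_fun setT (U : g_sigma_algebraType G -> R) ->
  P.-integrable setT (fun w => (U w * V w)%:E) ->
  (\int[P]_w (U w * V w)%:E = 0)%E.
Proof.
move=> sG iV V0 mU iUV.
have mV : measurable_fun setT V by apply/measurable_EFinP/measurable_int/iV.
(* The bound [X <= |U|] covers the positive and the negative part of [U] at once and makes [X * V]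
   integrable, although [U] alone need not be. *)
suff H (X : Omega -> R) : measurable_fun setT (X : g_sigma_algebraType G -> R) ->
    (forall w, 0 <= X w <= `|U w|) -> 
    P.-integrable setT (fun w => (X w * V w)%:E) /\ (\int[P]_w (X w * V w)%:E = 0)%E.
  have [i1 e1] : P.-integrable setT (fun w => (U^\+ w * V w)%:E) /\
      (\int[P]_w (U^\+ w * V w)%:E = 0)%E.
    apply: H; first exact: measurable_funrpos.
    by move=> w; rewrite funrpos_ge0 /= /funrpos ge_max ler_norm normr_ge0.
  have [i2 e2] : P.-integrable setT (fun w => (U^\- w * V w)%:E) /\
      (\int[P]_w (U^\- w * V w)%:E = 0)%E.
    apply: H; first exact: measurable_funrneg.
    by move=> w; rewrite funrneg_ge0 /= /funrneg ge_max -normrN ler_norm normr_ge0.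
  rewrite (_ : (fun w => _) = (fun w => (U^\+ w * V w)%:E - (U^\- w * V w)%:E)%E).
    by rewrite integralB// e1 e2 sube0.
  apply/funext => w; rewrite -EFinB -mulrBl; congr (_ * _)%:E.
  by rewrite -[in LHS](funrposBneg U).
move=> mX X01.
have mX' : measurable_fun setT X by move=> _ B mB; apply: sG; exact: mX.
have iXV : P.-integrable setT (fun w => (X w * V w)%:E).
  apply: le_integrable iUV => //.
    by apply/measurable_EFinP/measurable_funM.
  move=> w _ /=; rewrite lee_fin !normrM ler_wpM2r//.
  by have /andP[x0 xu] := X01 w; rewrite ger0_norm.
split=> //.
have mXE : measurable_fun setT (EFin \o X : g_sigma_algebraType G -> \bar R).
  exact/measurable_EFinP.
(* The approximation is built in the sigma-algebra generated by [G], so the level sets of each [s n]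
   are sets over which [V] integrates to zero. *)
pose s := nnsfun_approx measurableT mXE.
have X0 w : setT w -> (0 <= (EFin \o X) w)%E by rewrite lee_fin; case/andP: (X01 w).
have sX w : EFin \o s ^~ w @ \oo --> (X w)%:E :=
  cvg_nnsfun_approx measurableT mXE X0 (I : setT w).
have sB n (B : set R) : measurable B -> <<s G >> (s n @^-1` B).
  by move=> mB; have := @measurable_funPTI _ _ (g_sigma_algebraType G) _ (s n) B mB.
have ms n : measurable_fun setT (s n : Omega -> R).
  by move=> _ B mB; rewrite setTI; apply: sG; exact: sB.
have sle n w : 0 <= s n w <= X w.
  rewrite fun_ge0/= -lee_fin /s nnsfun_approxE.
  by rewrite (le_approx _ X0).
have s0 n : (\int[P]_w (s n w * V w)%:E = 0)%E.
  pose r : seq R := finmap.enum_fset (fset_set (s n @` setT)).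
  have mA y : <<s G >> (s n @^-1` [set y]).
    by apply: sB; exact: measurable_set1.
  pose h y w := (y%:E * (\1_(s n @^-1` [set y]) w * V w)%:E)%E.
  have ih y : P.-integrable setT (fun w => (\1_(s n @^-1` [set y]) w * V w)%:E).
    by apply: integrable_mul_indic => //; exact: sG.
  rewrite (_ : (\int[P]_w _)%E = \int[P]_w (\sum_(y <- r) h y w))%E; last first.
    apply: eq_integral => w _; rewrite fimfunE fsbig_finite//= mulr_suml -sumEFin.
    by apply: eq_bigr => y _; rewrite /h -!EFinM mulrA.
  rewrite integral_sum//; last by move=> y; exact: integrableZl.
  rewrite big1// => y _; rewrite /h integralZl//.
  by rewrite -integral_mul_indic V0// mule0.
have := @dominated_convergence _ _ _ P setT measurableT (fun n w => (s n w * V w)%:E) 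
  (fun w => (X w * V w)%:E) (fun w => `|X w * V w|%:E).
case.
- by move=> n; apply/measurable_EFinP/measurable_funM.
- by apply/measurable_EFinP/measurable_funM.
- apply: aeW => w _.
  by have : (((s n w)%:E * (V w)%:E) @[n --> \oo] --> (X w)%:E * (V w)%:E)%E;
    [apply: cvgeZr => //; exact: sX|exact].
- exact: integrable_norm iXV.
- apply: aeW => w n _ /=; rewrite lee_fin !normrM ler_wpM2r//.
  by have /andP[x0 xu] := sle n w; rewrite !ger0_norm// (le_trans x0).
move=> _ _ /cvg_lim <-//; rewrite (_ : (fun n => _) = cst 0%E) ?lim_cst//.
by apply/funext => n; exact: s0.
Qed.

(* Apply the previous lemma to the sigma-algebra of [V] and to the centred
   variable [\1_A - P A]. *)
Lemma integral_indep_eq0 (A : set Omega) (V : Omega -> R) :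
  measurable A -> measurable_fun setT V -> P.-integrable setT (EFin \o V) ->
  (\int[P]_w (V w)%:E = 0)%E ->
  (forall B, measurable B -> P (A `&` V @^-1` B) = P A * P (V @^-1` B))%E ->
  (\int[P]_(w in A) (V w)%:E = 0)%E.
Proof.
move=> mA mV iV V0 AV.
have PA : P A \is a fin_num := fin_num_measure P A mA.
pose a := fine (P A).
pose W w := \1_A w - a.
pose G := preimage_set_system setT V (@measurable _ R).
have sGE : <<s G >> = G.
  exact/sigma_algebra_id/sigma_algebra_preimage/sigma_algebra_measurable.
have mVB B : measurable B -> measurable (V @^-1` B).
  by move=> mB; rewrite -[X in measurable X]setTI; exact: mV.
have iA : P.-integrable setT (EFin \o (\1_A : Omega -> R)) by exact: integrable_indic.
have ia : P.-integrable setT (EFin \o (cst a : Omega -> R)).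
  exact: finite_measure_integrable_cst.
have iAV := integrable_mul_indic mA iV.
have iaV : P.-integrable setT (fun w => (a%:E * (V w)%:E)%E) by exact: integrableZl.
have VWE w : ((V w * W w)%:E = (\1_A w * V w)%:E - a%:E * (V w)%:E)%E.
  by rewrite -EFinM -EFinB /W; congr EFin; ring.
have := @integral_sub_sigma_mul_eq0 G V W.
rewrite sGE (eq_integral _ _ (fun w _ => VWE w)) integralB// integralZl// V0 mule0 sube0.
rewrite -integral_mul_indic; apply.
- by move=> _ [B mB <-]; exact: mV.
- rewrite (_ : EFin \o W = (EFin \o \1_A) \- (EFin \o cst a))%E; first exact: integrableB.
  by apply/funext => w.
- move=> _ [B mB <-]; rewrite setTI.
  have mB' := mVB _ mB.
  have -> : (\int[P]_(x in V @^-1` B) (W x)%:E =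
    \int[P]_(x in V @^-1` B) ((EFin \o \1_A) x - cst a%:E x))%E by [].
  rewrite integralB//; [|exact: integrableS iA|exact: integrableS ia].
  rewrite integral_indic// integral_cst// [X in (X - _)%E](AV _ mB) /a.
  by rewrite fineK// subee// fin_numM// fin_num_measure.
- exact: preimage_set_system_measurable_fun.
- rewrite (_ : (fun w => _) =
    (fun w => (\1_A w * V w)%:E - a%:E * (V w)%:E)%E); last exact/funext.
  exact: integrableB.
Qed.

(** The measurable sets over which [V] integrates to zero form a Dynkin system: complements use that
    the total integral vanishes, disjoint unions use integrability. The pi-lambda theorem then
    applies. *)
Lemma integral_pi_system_eq0 (G : set (set Omega)) (V : Omega -> R) :
  setI_closed G -> G `<=` measurable -> P.-integrable setT (EFin \o V) ->
  (\int[P]_w (V w)%:E = 0)%E ->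
  (forall A, G A -> \int[P]_(w in A) (V w)%:E = 0)%E ->
  (forall A, <<s G >> A -> \int[P]_(w in A) (V w)%:E = 0)%E.
Proof.
move=> GI Gm iV V0 GV.
suff : <<s G >> `<=` [set A | measurable A /\ (\int[P]_(w in A) (V w)%:E = 0)%E].
  by move=> H A /H[].
rewrite -setI_closed_g_dynkin_g_sigma_algebra//; apply: smallest_sub; last first.
  by move=> A GA; split; [exact: Gm|exact: GV].
split=> //.
- move=> A [mA A0]; split; first exact: measurableC.
  have : (\int[P]_w ((\1_(~` A) w * V w)%:E + (\1_A w * V w)%:E) = 0)%E.
    rewrite -[RHS]V0; apply: eq_integral => w _.
    by rewrite -EFinD -mulrDl !indicE in_setC; case: (w \in A); rewrite ?add0r ?addr0 mul1r.
  rewrite integralD//; last 2 first.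
  + exact: integrable_mul_indic (measurableC mA) iV.
  + exact: integrable_mul_indic.
  by rewrite -!integral_mul_indic A0 adde0.
- move=> F tF GF; split; first by apply: bigcup_measurable => k _; case: (GF k).
  rewrite integral_bigcup//.
  + by rewrite eseries0// => k _ _; case: (GF k).
  + by move=> k; case: (GF k).
  + by apply: integrableS iV => //; apply: bigcup_measurable => k _; case: (GF k).
Qed.

Variables (K : finType) (E : K -> set (set Omega)).
Hypothesis mE : forall k, E k `<=` measurable.
Hypothesis EI : forall k, setI_closed (E k).
Hypothesis indepE : mutually_independent P E.

(** Finite intersections on which mutual independence is literally a product formula. They form a
    pi-system, so identities checked on them extend to the joint sigma-algebra of the family over
    [J]. *)
Definition cylinders (J : {set K}) : set (set Omega) :=
  [set \bigcap_(k in [set k | k \in J]) A k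
  | A in [set A : K -> set Omega | forall k, k \in J -> E k (A k)]].

Lemma cylinders_setI (J : {set K}) : setI_closed (cylinders J).
Proof.
move=> _ _ [A JA <-] [B JB <-]; exists (fun k => A k `&` B k).
  by move=> k kJ; apply: EI; [exact: JA|exact: JB].
by rewrite bigcapI.
Qed.

Lemma cylinders_measurable (J : {set K}) : cylinders J `<=` measurable.
Proof.
move=> _ [A JA <-]; apply: fin_bigcap_measurable => [|k kJ]; first exact: finite_finpred.
exact/mE/JA.
Qed.

Lemma cylinders_mem (J : {set K}) k A : (forall k', E k' setT) -> k \in J -> E k A ->
  cylinders J A.
Proof.
move=> ET kJ kA; exists (fun k' => if k' == k then A else setT).
  by move=> k' _; case: eqP => [->|].
apply/seteqP; split=> [w /(_ k kJ)|w Aw k' _]; first by rewrite eqxx.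
by case: eqP.
Qed.

(** Since [k0] lies outside [J], [V] is independent of each cylinder over [J] and integrates to zero
    over it; the pi-system lemma and then orthogonality finish the argument. *)
Lemma integral_indep_mul_eq0 (J : {set K}) k0 (U V : Omega -> R) :
  k0 \notin J ->
  (forall B, measurable B -> E k0 (V @^-1` B)) ->
  P.-integrable setT (EFin \o V) -> (\int[P]_w (V w)%:E = 0)%E ->
  measurable_fun setT (U : g_sigma_algebraType (cylinders J) -> R) ->
  P.-integrable setT (fun w => (U w * V w)%:E) ->
  (\int[P]_w (U w * V w)%:E = 0)%E.
Proof.
move=> k0J EV iV V0 mU iUV.
apply: (@integral_sub_sigma_mul_eq0 (cylinders J)) => //.
  apply: smallest_sub; first exact: sigma_algebra_measurable.
  exact: cylinders_measurable.
apply: integral_pi_system_eq0 => //.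
- exact: cylinders_setI.
- exact: cylinders_measurable.
move=> A cA; apply: integral_indep_eq0 => //; first exact: cylinders_measurable cA.
  by apply/measurable_EFinP/measurable_int/iV.
case: cA => {}A JA <- B mB.
(* Adding the event of [V] at the index [k0] turns the intersection into a single cylinder over
   [k0 |: J], to which [indepE] applies. *)
pose A' k := if k == k0 then V @^-1` B else A k.
have A'J k : k \in J -> A' k = A k.
  by rewrite /A'; case: eqP => // ->; rewrite (negPf k0J).
have -> : \bigcap_(k in [set k | k \in J]) A k `&` V @^-1` B =
    \bigcap_(k in [set k | k \in k0 |: J]) A' k.
  apply/seteqP; split => [w [JAw Vw] k /=|w H].
    rewrite in_setU1 => /predU1P[->|kJ]; first by rewrite /A' eqxx.
    by rewrite A'J//; exact: JAw.
  split; last by have := H k0; rewrite /A' eqxx; apply; rewrite /= setU11.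
  by move=> k /= kJ; rewrite -A'J//; apply: H; rewrite /= setU1r.
rewrite indepE; last first.
  move=> k; rewrite in_setU1 => /predU1P[->|kJ]; first by rewrite /A' eqxx; exact: EV.
  by rewrite A'J//; exact: JA.
rewrite big_setU1//= {1}/A' eqxx muleC; congr (_ * _)%E.
by rewrite indepE//; apply: eq_bigr => k kJ; rewrite A'J.
Qed.

End Orthogonality.

(** * Smooth functions *)

Section Smoothness.
Context {R : realType} {d : nat}.
Implicit Types (F : 'rV[R]_d -> R) (x y v : 'rV[R]_d).

Lemma diff_grad F x v : differentiable F x -> 'd F x v = dotv (grad F x) v.
Proof.
move=> dF; rewrite {1}(row_sum_delta v) linear_sum.
by apply: eq_bigr => j _; rewrite linearZ /= mxE mulrC.
Qed.

Lemma is_derive_line F x v (t : R) : differentiable F (x + t *: v) ->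
  is_derive t (1 : R) (fun s : R => F (x + s *: v)) (dotv (grad F (x + t *: v)) v).
Proof.
move=> dF; have dFv : derivable F (x + t *: v) v by exact: diff_derivable.
have E : (fun h : R => h^-1 *: (((fun s : R => F (x + s *: v)) \o shift t) (h *: (1 : R)) -
    F (x + t *: v))) =
    (fun h : R => h^-1 *: ((F \o shift (x + t *: v)) (h *: v) - F (x + t *: v))).
  apply/funext => h /=; congr (_ *: (F _ - _)).
  by rewrite -[h%:A]/(h * 1) mulr1 scalerDl addrCA.
apply: DeriveDef; first by rewrite /derivable E.
by rewrite /derive E -diff_grad// -deriveE.
Qed.

(** Subtracting the quadratic bound along the segment leaves [k], whose derivative [<grad F(x + t v)
    - grad F(x), v> - G t |v|^2] is nonpositive for [t >= 0] by Cauchy-Schwarz and the Lipschitz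
    bound. The mean value theorem gives [k 1 <= k 0]. *)
Lemma descent_lemma F (G : R) x y : (forall z, differentiable F z) ->
  (forall z z', enorm (grad F z - grad F z') <= G * enorm (z - z')) ->
  F y <= F x + dotv (grad F x) (y - x) + G / 2 * dotv (y - x) (y - x).
Proof.
move=> dF GF; set v := y - x; set a := dotv _ v; set b := dotv v v.
pose k (t : R) : R := F (x + t *: v) - (t * a + G / 2 * (t ^+ 2 * b)).
pose k' (t : R) : R := dotv (grad F (x + t *: v)) v - (a + G * (t * b)).
have dk (t : R) : is_derive t (1 : R) k (k' t).
  have dl := @is_derive_line F x v t (dF _).
  have da := @is_deriveM R R^o id (cst a) t 1 _ _ (is_derive_id t 1) (is_derive_cst _ _ _).
  have d2 := @is_deriveM R R^o _ (cst (G / 2 * b)) t 1 _ _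
    (@is_deriveX R R^o id 2 t 1 _ (is_derive_id _ _)) (is_derive_cst _ _ _).
  have := @is_deriveB R R^o R^o _ _ t 1 _ _ dl (@is_deriveD R R^o R^o _ _ t 1 _ _ da d2).
  move=> H.
  have -> : k = (fun s : R => F (x + s *: v)) - (id * cst a + id ^+ 2 * cst (G / 2 * b)).
    by apply/funext => s; rewrite /k !fctE /=; congr (_ - (_ + _)); rewrite mulrCA.
  apply: (is_derive_eq H); by rewrite /k' /GRing.scale/=; field.
have ck : {within `[0, 1], continuous (k : R -> R)}.
  apply: continuous_subspaceT => r; apply: differentiable_continuous.
  exact/derivable1_diffP/(@ex_derive _ R^o R^o _ _ _ _ (dk r)).
have [c c01 kE] := MVT (@ltr01 R) (fun t _ => dk t) ck.
have : k 1 - k 0 <= 0.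
  rewrite kE subr0 mulr1 /k' opprD addrA -dotvNl -dotvDl subr_le0.
  have c0 : 0 <= c by move: c01; rewrite in_itv/= => /andP[/ltW].
  apply: (le_trans (ler_norm _)); apply: (le_trans (cauchy_schwarz _ _)).
  rewrite /b -sqr_enorm expr2 !mulrA ler_wpM2r ?enorm_ge0//.
  apply: (le_trans (GF _ _)); rewrite (addrC x) addrK -mulrA.
  by rewrite {1}/enorm dotvZl dotvZr mulrA -expr2 sqrtrM ?sqr_ge0// sqrtr_sqr ger0_norm.
have -> : k 1 = F y - (a + G / 2 * b).
  by rewrite /k scale1r /v (addrC x) subrK expr1n !mul1r.
have -> : k 0 = F x by rewrite /k scale0r addr0 expr0n/= !mul0r mulr0 addr0 subr0.
lra.
Qed.

End Smoothness.

(** * Measurability of vector-valued maps *)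

Section MeasurableVectors.
Context {dO : measure_display} {T : measurableType dO} {R : realType} {d : nat}.
Implicit Types (g h : T -> 'rV[R]_d) (F : 'rV[R]_d -> R).

(** Coordinatewise, as in the hypothesis on the noise. The domain is arbitrary so that the same
    lemmas serve for [Omega] with a smaller sigma-algebra and for Borel vectors. *)
Definition measurable_vec h := forall j, measurable_fun setT (fun w => h w 0 j).

Lemma measurable_vec_cst v : measurable_vec (fun=> v).
Proof. by move=> j; exact: measurable_cst. Qed.

Lemma measurable_vecD g h : measurable_vec g -> measurable_vec h ->
  measurable_vec (fun w => g w + h w).
Proof.
move=> mg mh j; under eq_fun do rewrite mxE.
exact: measurable_funD.
Qed.

Lemma measurable_vecZ (a : T -> R) h : measurable_fun setT a ->
  measurable_vec h -> measurable_vec (fun w => a w *: h w).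
Proof.
move=> ma mh j; under eq_fun do rewrite mxE.
exact: measurable_funM.
Qed.

Lemma measurable_vecB g h : measurable_vec g -> measurable_vec h ->
  measurable_vec (fun w => g w - h w).
Proof.
move=> mg mh; apply: measurable_vecD => // j.
under eq_fun do rewrite mxE; exact: measurable_funN.
Qed.

Lemma measurable_vec_sum (I : Type) (s : seq I) (f : I -> T -> 'rV[R]_d) :
  (forall i, measurable_vec (f i)) ->
  measurable_vec (fun w => \sum_(i <- s) f i w).
Proof.
move=> mf j; under eq_fun do rewrite summxE.
by apply: measurable_sum => i; exact: mf.
Qed.

Lemma measurable_dotv g h : measurable_vec g -> measurable_vec h ->
  measurable_fun setT (fun w => dotv (g w) (h w)).
Proof. by move=> mg mh; apply: measurable_sum => j; exact: measurable_funM. Qed.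

Lemma measurable_enorm h : measurable_vec h ->
  measurable_fun setT (fun w => enorm (h w)).
Proof.
move=> mh; have ms : measurable_fun setT (@Num.sqrt R).
  by apply: continuous_measurable_fun; exact: sqrt_continuous.
exact: (measurableT_comp ms (measurable_dotv mh mh)).
Qed.

Lemma measurable_clip c h : 0 < c -> measurable_vec h ->
  measurable_vec (fun w => clip (h w) c).
Proof.
move=> c0 mh; under [X in measurable_vec X]eq_fun do rewrite clipE_max//.
apply: measurable_vecZ => //.
have mc : measurable_fun setT (fun y : R => c / Num.max c y).
  apply: continuous_measurable_fun => y; apply: cvgM; first exact: cvg_cst.
  apply: cvgV; first by rewrite gt_eqF// lt_max c0.
  by apply: (@continuous_max R R (cst c) id y); [exact: cvg_cst|exact: cvg_id].
exact: (measurableT_comp mc (measurable_enorm mh)).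
Qed.

(* [h] is approximated by the countably-valued maps [q k \o z k], obtained by
   rounding its coordinates down to multiples of [1 / k.+1]. *)
Lemma measurable_continuous_vec F h : continuous F -> measurable_vec h ->
  measurable_fun setT (fun w => F (h w)).
Proof.
move=> cF mh.
pose q k (z : 'rV[int]_d) : 'rV[R]_d := \row_j ((z 0 j)%:~R / k.+1%:R).
pose z k w : 'rV[int]_d := \row_j Num.floor (h w 0 j * k.+1%:R).
apply: (@measurable_fun_cvg _ _ _ _ (fun k w => F (q k (z k w)))).
  move=> k _ B mB; rewrite setTI.
  pose A n := if unpickle n is Some y then
    (if F (q k y) \in B then
       \bigcap_(j in [set: 'I_d]) [set w | Num.floor (h w 0 j * k.+1%:R) = y 0 j]
     else set0) else set0.
  have -> : (fun w => F (q k (z k w))) @^-1` B = \bigcup_n A n.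
    apply/seteqP; split=> [w /= Bw|w [n _]].
      exists (pickle (z k w)) => //; rewrite /A pickleK mem_set//.
      by move=> j _ /=; rewrite mxE.
    rewrite /A; case: unpickle => // y; case: ifP => // /set_mem By yE /=.
    rewrite (_ : z k w = y)//; apply/rowP => j; rewrite mxE; exact: yE.
  apply: bigcupT_measurable => n; rewrite /A; case: unpickle => [y|]; last exact: measurable0.
  case: ifP => _; last exact: measurable0.
  apply: fin_bigcap_measurable => [|j _]; first exact: finite_finset.
  have -> : [set w | Num.floor (h w 0 j * k.+1%:R) = y 0 j] =
     (fun w => h w 0 j * k.+1%:R) @^-1` `[(y 0 j)%:~R, (y 0 j + 1)%:~R[%classic.
    apply/seteqP; split => w /=; rewrite in_itv/= => H.
      by rewrite -H floor_itv.
    exact: floor_def.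
  rewrite -[X in measurable X]setTI; apply: measurable_funM => //.
move=> w _; apply: (cvg_comp _ F); last exact: cF.
apply/cvg_ballP => e e0; near=> k; split => // i j.
rewrite (ord1 i) /ball/= !mxE.
have k0 : 0 < k.+1%:R :> R by rewrite ltr0n.
have /andP[l u] := floor_itv (h w 0 j * k.+1%:R).
rewrite /ball_ /=; set m := _%:~R in l *.
have -> : h w 0 j - m / k.+1%:R = (h w 0 j * k.+1%:R - m) / k.+1%:R.
  by rewrite mulrBl mulfK ?gt_eqF.
rewrite ger0_norm ?divr_ge0 ?subr_ge0// ?ltW//.
apply: (@lt_trans _ _ k.+1%:R^-1); last by near: k; exact: (near_infty_natSinv_lt (PosNum e0)).
rewrite -[ltRHS]mul1r ltr_pM2r ?invr_gt0// ltrBlDl.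
by move: u; rewrite intrD.
Unshelve. all: by end_near. Qed.

(** Each coordinate is a pointwise limit of difference quotients of the continuous [F] with steps
    [1 / k.+1]. This covers the individual losses, which are only assumed differentiable. *)
Lemma measurable_grad F h : (forall y, differentiable F y) -> measurable_vec h ->
  measurable_vec (fun w => grad F (h w)).
Proof.
move=> dF mh j; have cF : continuous F by move=> y; exact: differentiable_continuous.
under eq_fun do rewrite mxE.
pose e : 'rV[R]_d := delta_mx 0 j.
apply: (@measurable_fun_cvg _ _ _ _
   (fun k w => k.+1%:R * (F (h w + k.+1%:R^-1 *: e) - F (h w)))).
  move=> k; apply: measurable_funM => //; apply: measurable_funB.
    exact: (measurable_continuous_vec cF
      (measurable_vecD mh (measurable_vec_cst (k.+1%:R^-1 *: e)))).
  exact: measurable_continuous_vec.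
move=> w _.
have := @diff_derivable _ _ _ F (h w) e (dF _).
rewrite /derivable => /cvg_ex[l Fl].
have Fe : 'd F (h w) e = l by rewrite -deriveE//; exact/cvg_lim.
rewrite Fe.
move: Fl => /cvgr_dnbhsP /(_ (fun k => k.+1%:R^-1)) H.
rewrite (_ : (fun k => _) = (fun k => k.+1%:R^-1^-1 *:
    ((F \o shift (h w)) (k.+1%:R^-1 *: e) - F (h w)))).
  by apply: H; split => [k|]; [rewrite invr_neq0|exact: cvg_harmonic].
by apply/funext => k; rewrite invrK /= (addrC (h w)).
Qed.
End MeasurableVectors.

Lemma measurable_vec_Borel (R : realType) (d : nat) :
  measurable_vec (fun z : BorelRd R d => z : 'rV[R]_d).
Proof.
move=> j; apply: (measurability _ (RGenOpens.measurableE R)) => _ [_ [a [b ->] <-]].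
rewrite setTI; apply: sub_sigma_algebra; apply: open_comp => [z _|].
  exact: coord_continuous.
exact: interval_open.
Qed.


(** * Symmetric distributions and the Wasserstein distance *)

Section WassersteinBound.
Context {R : realType} {d : nat} (w : 'rV[R]_d) (c : R).
Hypothesis c0 : 0 < c.

Definition clip_dot (z : 'rV[R]_d) : R := dotv w (clip (w + z) c).

(* Nonnegative, since [|<w, clip g>| <= |w| c]. *)
Definition shifted_clip_dot (z : 'rV[R]_d) : R := clip_dot z + enorm w * c.

Lemma measurable_clip_dot : measurable_fun setT (clip_dot : BorelRd R d -> R).
Proof.
apply: measurable_dotv; first exact: measurable_vec_cst.
apply: measurable_clip => //; apply: measurable_vecD; first exact: measurable_vec_cst.
exact: measurable_vec_Borel.
Qed.

Lemma measurable_shifted_clip_dot :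
  measurable_fun setT (shifted_clip_dot : BorelRd R d -> R).
Proof. by apply: measurable_funD => //; exact: measurable_clip_dot. Qed.

Lemma shifted_clip_dot_ge0 z : 0 <= shifted_clip_dot z.
Proof.
have := dotv_clip_le w (w + z) c0; rewrite ler_norml => /andP[h _].
by rewrite /shifted_clip_dot /clip_dot -lerBlDr sub0r.
Qed.

Lemma measurable_opp_Borel : measurable_fun setT (-%R : BorelRd R d -> BorelRd R d).
Proof.
apply: (@measurability _ _ (BorelRd R d) (BorelRd R d) setT -%R
  (@open 'rV[R]_d) erefl) => _ [B oB <-].
rewrite setTI; apply: sub_sigma_algebra; apply: open_comp => // z _.
exact: opp_continuous.
Qed.

(** [empirical] is a bare set function, so the statement concerns a measure agreeing with it on
    measurable sets, such as the second marginal of a coupling. Such a measure integrates like a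
    scaled sum of Dirac masses. *)
Lemma ge0_integral_empirical (n : nat) (xs : 'I_n -> 'rV[R]_d)
    (mu : {measure set (BorelRd R d) -> \bar R}) (f : BorelRd R d -> R) :
  (forall A, measurable A -> mu A = empirical xs A) ->
  measurable_fun setT f -> (forall z, 0 <= f z) ->
  (\int[mu]_z (f z)%:E = (n%:R^-1 * \sum_(i < n) f (xs i))%:E)%E.
Proof.
case: n xs => [|n] xs muE mf f0.
  rewrite (@eq_measure_integral _ _ _ _ mzero); last first.
    by move=> A mA _; apply: (etrans (muE _ mA)); rewrite /empirical big_ord0 mulr0.
  by rewrite integral_measure_zero big_ord0 mulr0.
have n0 : 0 <= n.+1%:R^-1 :> R by rewrite invr_ge0.
pose m k : {measure set (BorelRd R d) -> \bar R} := \d_(xs (inord k) : BorelRd R d).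
have mE : measurable_fun setT (fun z => (f z)%:E) by exact/measurable_EFinP.
rewrite (@eq_measure_integral _ _ _ _ (mscale (NngNum n0) (msum m n.+1))); last first.
  move=> A mA _; apply: (etrans (muE _ mA)).
  rewrite /mscale/= /msum /empirical EFinM -sumEFin; congr (_ * _)%E.
  by apply: eq_bigr => i _; rewrite /m /= diracE inord_val.
have fE0 z : setT z -> (0 <= (f z)%:E)%E by rewrite lee_fin.
rewrite (ge0_integral_mscale _ _ _ mE fE0)//.
rewrite (ge0_integral_measure_sum _ measurableT fE0 mE) EFinM -sumEFin.
congr (_ * _)%E; apply: eq_bigr => i _.
by rewrite integral_dirac// diracE in_setT mul1e inord_val.
Qed.

(** Twice the integral is that of [shifted_clip_dot z + shifted_clip_dot (- z)]. On the ball
    [clip_sym_ge_hc] bounds it below; outside, [clip_sym_ge0] keeps at least the two shifts. *)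
Lemma symmetric_clip_bound (p : probability (BorelRd R d) R) : symmetric_distr p ->
  (p [set z : 'rV[R]_d | (enorm z < c / 4)%R] * (hc c (enorm w))%:E + (enorm w * c)%:E <=
   \int[p]_z (shifted_clip_dot z)%:E)%E.
Proof.
move=> sp; set S := [set z : 'rV[R]_d | _].
have mf : measurable_fun setT (fun z : BorelRd R d => (shifted_clip_dot z)%:E).
  by apply/measurable_EFinP; exact: measurable_shifted_clip_dot.
have mfN : measurable_fun setT (fun z : BorelRd R d => (shifted_clip_dot (- z))%:E).
  exact: (measurableT_comp mf measurable_opp_Borel).
have f0 z : (0 <= (shifted_clip_dot z)%:E)%E by rewrite lee_fin shifted_clip_dot_ge0.
have mS : measurable (S : set (BorelRd R d)).
  rewrite (_ : S = setT `&` (fun z : BorelRd R d => enorm z) @^-1` `]-oo, (c / 4)[%classic).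
    exact: (measurable_enorm (@measurable_vec_Borel R d) measurableT (measurable_itv _)).
  by rewrite setTI; apply/seteqP; split=> z /=; rewrite in_itv.
have hc0 : 0 <= hc c (enorm w) by rewrite hc_ge0 ?enorm_ge0 ?ltW.
have IN : (\int[p]_z (shifted_clip_dot z)%:E = \int[p]_z (shifted_clip_dot (- z))%:E)%E.
  rewrite -(@ge0_integral_pushforward _ _ _ _ _ _ measurable_opp_Borel p setT
    (fun z => (shifted_clip_dot z)%:E))//.
  apply: eq_measure_integral => [|mN A mA _]; first exact: measurable_opp_Borel.
  exact: (esym (sp A mA)).
have mi : measurable_fun setT (fun z : BorelRd R d => (\1_S z)%:E : \bar R).
  by apply/measurable_EFinP; exact: measurable_indic.
set h := hc c (enorm w) in hc0 *; set K := enorm w * c.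
have K0 : 0 <= K by rewrite mulr_ge0 ?enorm_ge0 ?ltW.
set I := (\int[p]_z _)%E in IN *.
suff : (2%:E * (p S * h%:E + K%:E) <= 2%:E * I)%E by rewrite lee_pmul2l.
have -> : (2%:E * I = \int[p]_z ((shifted_clip_dot z)%:E + (shifted_clip_dot (- z))%:E))%E.
  by rewrite ge0_integralD// -IN mule_natl mule2n.
have -> : (2%:E * (p S * h%:E + K%:E) = \int[p]_z ((2 * h * \1_S z + 2 * K)%:E))%E.
  have i0 (z : BorelRd R d) : setT z -> (0 <= (\1_S z)%:E :> \bar R)%E by rewrite lee_fin.
  have mhi : measurable_fun setT (fun z : BorelRd R d => (2 * h)%:E * (\1_S z)%:E)%E.
    exact: emeasurable_funM.
  have hi0 (z : BorelRd R d) : setT z -> (0 <= (2 * h)%:E * (\1_S z)%:E)%E.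
    by move=> _; rewrite mule_ge0// lee_fin ?mulr_ge0.
  have K20 : (0 <= (2 * K)%:E)%E by rewrite lee_fin mulr_ge0.
  transitivity (\int[p]_z ((2 * h)%:E * (\1_S z)%:E + cst (2 * K)%:E z))%E; last first.
    by apply: eq_integral => z _; rewrite -EFinM.
  rewrite (ge0_integralD _ measurableT hi0 mhi (fun _ _ => K20) (measurable_cst _))//.
  rewrite (ge0_integralZl _ measurableT mi i0)//; last by rewrite lee_fin mulr_ge0.
  rewrite integral_indic// setIT integral_cst//.
  rewrite [X in (_ = _ + _ * X)%E](@probability_setT _ _ _ p) mule1.
  rewrite ge0_muleDr ?lee_fin ?mule_ge0//.
  by congr (_ + _)%E; rewrite EFinM // -muleA; congr (_ * _)%E; exact: muleC.
apply: ge0_le_integral => //.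
- move=> z _; rewrite lee_fin; apply: addr_ge0; last exact: mulr_ge0.
  by apply: mulr_ge0 => //; exact: mulr_ge0.
- apply/measurable_EFinP; apply: measurable_funD => //; apply: measurable_funM => //.
- exact: emeasurable_funD.
move=> z _; rewrite -EFinD lee_fin /shifted_clip_dot.
suff : 2 * h * \1_S z <= clip_dot z + clip_dot (- z) by rewrite /K; lra.
rewrite indicE; have [zS|_] := boolP (z \in S); last first.
  by rewrite mulr0; exact: clip_sym_ge0.
by rewrite mulr1; apply: clip_sym_ge_hc => //; rewrite inE in zS.
Qed.

(** Integrate [clip_dot z.1 <= clip_dot z.2 + dcost w c z.1 z.2] against the coupling: the cost is
    exactly the variation of the function being compared. *)
Lemma coupling_clip_bound (n : nat) (xs : 'I_n -> 'rV[R]_d)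
    (p : probability (BorelRd R d) R)
    (g : probability (BorelRd R d * BorelRd R d)%type R) :
  coupling p (empirical xs) g -> (0 < n)%N ->
  (\int[p]_z (shifted_clip_dot z)%:E <=
   (n%:R^-1 * \sum_(i < n) clip_dot (xs i) + enorm w * c)%:E +
   \int[g]_z (dcost w c z.1 z.2)%:E)%E.
Proof.
move=> [g1 g2] n0.
pose f (z : BorelRd R d) := (shifted_clip_dot z)%:E.
have mf : measurable_fun setT f.
  by apply/measurable_EFinP; exact: measurable_shifted_clip_dot.
have f0 z : (0 <= f z)%E by rewrite lee_fin shifted_clip_dot_ge0.
have m1 := @measurable_fst _ _ (BorelRd R d) (BorelRd R d).
have m2 := @measurable_snd _ _ (BorelRd R d) (BorelRd R d).
have -> : (\int[p]_z (shifted_clip_dot z)%:E = \int[g]_z f z.1)%E.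
  rewrite -(@ge0_integral_pushforward _ _ _ _ _ _ m1 g setT f)//.
  apply: eq_measure_integral => A mA _.
  apply: (etrans (esym (g1 _ mA))); rewrite (_ : A `*` setT = fst @^-1` A)//.
  by apply/seteqP; split => z //= [].
have I2 : (\int[g]_z f z.2 = (n%:R^-1 * \sum_(i < n) clip_dot (xs i) + enorm w * c)%:E)%E.
  rewrite -(@ge0_integral_pushforward _ _ _ _ _ _ m2 g setT f)//.
  rewrite (@ge0_integral_empirical n xs).
  - congr EFin; rewrite big_split/= mulrDr; congr (_ + _).
    rewrite sumr_const card_ord -mulrnAl mulrA -(mulr_natl (enorm w)) mulrA.
    by rewrite mulVf ?mul1r// pnatr_eq0 -lt0n.
  - move=> A mA; apply: etrans (g2 _ mA); rewrite (_ : setT `*` A = snd @^-1` A)//.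
    by apply/seteqP; split => z //= [].
  - exact: measurable_shifted_clip_dot.
  - exact: shifted_clip_dot_ge0.
have mf1 := measurableT_comp mf m1.
have mf2 := measurableT_comp mf m2.
have md : measurable_fun setT
    (fun z : BorelRd R d * BorelRd R d => (dcost w c z.1 z.2)%:E).
  apply/measurable_EFinP/measurableT_comp => //; apply: measurable_funB.
    exact: (measurableT_comp measurable_clip_dot m1).
  exact: (measurableT_comp measurable_clip_dot m2).
have d0 (z : BorelRd R d * BorelRd R d) : setT z -> (0 <= (dcost w c z.1 z.2)%:E)%E.
  by rewrite lee_fin normr_ge0.
rewrite -I2 -(ge0_integralD _ measurableT (fun z _ => f0 z.2) mf2 d0 md).
apply: ge0_le_integral => //; first exact: emeasurable_funD.
move=> z _; rewrite /f -EFinD lee_fin /shifted_clip_dot /dcost.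
rewrite -/(clip_dot z.1) -/(clip_dot z.2).
have := ler_norm (clip_dot z.1 - clip_dot z.2); lra.
Qed.

Lemma wasserstein_clip_bound (n : nat) (xs : 'I_n -> 'rV[R]_d)
    (p : probability (BorelRd R d) R) : (0 < n)%N -> symmetric_distr p ->
  (p [set z : 'rV[R]_d | (enorm z < c / 4)%R] * (hc c (enorm w))%:E <=
   (n%:R^-1 * \sum_(i < n) clip_dot (xs i))%:E + wasserstein w c p (empirical xs))%E.
Proof.
move=> n0 sp; rewrite -leeBlDl//.
apply: le_ereal_inf_tmp => _ [g gc <-].
have := le_trans (symmetric_clip_bound sp) (coupling_clip_bound gc n0).
rewrite EFinD addeAC leeD2rE// => H.
by rewrite leeBlDl.
Qed.

Lemma wasserstein_ge0 p p' : (0 <= wasserstein w c p p')%E.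
Proof.
apply: le_ereal_inf_tmp => _ [g _ <-].
by apply: integral_ge0 => z _; rewrite lee_fin normr_ge0.
Qed.

End WassersteinBound.

(** * Expectations of real random variables *)

Section Expectation.
Context {dO : measure_display} {Omega : measurableType dO} {R : realType}.
Variable P : probability Omega R.
Implicit Types (f g : Omega -> R) (a b : R).

(** Integrability travels with the value, so linear combinations of expectations assemble without
    side conditions. *)
Definition has_expectation f a :=
  P.-integrable setT (EFin \o f) /\ (\int[P]_w (f w)%:E = a%:E)%E.

Lemma has_expectation_fine f : P.-integrable setT (EFin \o f) ->
  has_expectation f (fine (\int[P]_w (f w)%:E)).
Proof. by move=> fi; split=> //; rewrite fineK//; exact: integrable_fin_num. Qed.

Lemma has_expectation_cst a : has_expectation (fun=> a) a.
Proof.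
split; first exact: finite_measure_integrable_cst.
by rewrite (integral_cst P measurableT a%:E) [X in (_ * X)%E](@probability_setT _ _ _ P) mule1.
Qed.

Lemma has_expectationD f g a b : has_expectation f a -> has_expectation g b ->
  has_expectation (fun w => f w + g w) (a + b).
Proof.
move=> [fi fa] [gi gb]; split.
  rewrite (_ : EFin \o _ = (EFin \o f) \+ (EFin \o g))%E; first exact: integrableD.
  exact/funext.
by under eq_integral do rewrite EFinD; rewrite integralD// fa gb.
Qed.

Lemma has_expectationZ a f b : has_expectation f b ->
  has_expectation (fun w => a * f w) (a * b).
Proof.
move=> [fi fb]; split.
  rewrite (_ : EFin \o _ = (fun w => a%:E * (EFin \o f) w))%E; first exact: integrableZl.
  exact/funext.
by under eq_integral do rewrite EFinM; rewrite integralZl// fb.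
Qed.

Lemma has_expectation_sum (I : Type) (s : seq I) (f : I -> Omega -> R) (a : I -> R) :
  (forall i, has_expectation (f i) (a i)) ->
  has_expectation (fun w => \sum_(i <- s) f i w) (\sum_(i <- s) a i).
Proof.
move=> fa; elim: s => [|i s IH].
  rewrite big_nil; under [X in has_expectation X]eq_fun do rewrite big_nil.
  exact: has_expectation_cst.
rewrite big_cons; under [X in has_expectation X]eq_fun do rewrite big_cons.
exact: has_expectationD.
Qed.

Lemma has_expectation_unique f a b :
  has_expectation f a -> has_expectation f b -> a = b.
Proof. by move=> [_ fa] [_ fb]; apply: EFin_inj; rewrite -fa. Qed.

Lemma has_expectation_le f g a b : has_expectation f a -> has_expectation g b ->
  (forall w, f w <= g w) -> a <= b.
Proof.
move=> [fi fa] [gi gb] fg; rewrite -lee_fin -fa -gb.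
by apply: le_integral => // w _; rewrite lee_fin.
Qed.

Lemma integrable_bounded f g : measurable_fun setT f ->
  (forall w, `|f w| <= g w) -> P.-integrable setT (EFin \o g) ->
  P.-integrable setT (EFin \o f).
Proof.
move=> mf fg; apply: le_integrable => //; first exact/measurable_EFinP.
by move=> w _; rewrite lee_fin (le_trans (fg w))// ler_norm.
Qed.

Lemma integrable_mul_sqr f g : measurable_fun setT f -> measurable_fun setT g ->
  P.-integrable setT (fun w => (f w ^+ 2)%:E) ->
  P.-integrable setT (fun w => (g w ^+ 2)%:E) ->
  P.-integrable setT (fun w => (f w * g w)%:E).
Proof.
move=> mf mg fi gi; apply: (@integrable_bounded _ (fun w => f w ^+ 2 + g w ^+ 2)).
- exact: measurable_funM.
- move=> w; rewrite normrM -(real_normK (num_real (f w))) -(real_normK (num_real (g w))).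
  have := sqr_ge0 (`|f w| - `|g w|); have := normr_ge0 (f w); have := normr_ge0 (g w); nra.
- by have [] := has_expectationD (has_expectation_fine fi) (has_expectation_fine gi).
Qed.

(* Splits the signed [f] so that only integrals of nonnegative functions are
   added: [W] may take the value [+oo]. *)
Lemma integral_le_add f a (L W : Omega -> \bar R) : has_expectation f a ->
  measurable_fun setT L -> measurable_fun setT W ->
  (forall w, 0 <= L w)%E -> (forall w, 0 <= W w)%E ->
  (forall w, L w <= (f w)%:E + W w)%E ->
  (\int[P]_w L w <= a%:E + \int[P]_w W w)%E.
Proof.
move=> [fi fa] mL mW L0 W0 LfW.
have mf : measurable_fun setT f by apply/measurable_EFinP/measurable_int/fi.
have ip : P.-integrable setT (EFin \o f^\+) by exact: integrable_funrpos.
have im : P.-integrable setT (EFin \o f^\-) by exact: integrable_funrneg.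
have [_ ep] := has_expectation_fine ip.
have [_ em] := has_expectation_fine im.
set p := fine _ in ep; set q := fine _ in em.
have apq : a = p - q.
  apply: EFin_inj; rewrite -fa EFinB -ep -em -integralB//; apply: eq_integral => w _.
  by rewrite -EFinB -[in LHS](funrposBneg f).
have mp : measurable_fun setT (fun w => (f^\+ w)%:E) by apply: measurable_int ip.
have mq : measurable_fun setT (fun w => (f^\- w)%:E) by apply: measurable_int im.
have : (\int[P]_w (L w + (f^\- w)%:E) <= \int[P]_w ((f^\+ w)%:E + W w))%E.
  apply: ge0_le_integral => //.
  - by move=> w _; rewrite adde_ge0// lee_fin.
  - exact: emeasurable_funD.
  - exact: emeasurable_funD.
  move=> w _; rewrite -leeBrDr// addeAC -EFinB.
  rewrite (_ : f^\+ w - f^\- w = f w)//.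
  by rewrite -[in RHS](funrposBneg f).
rewrite !ge0_integralD//; last 2 first.
  by move=> w _; rewrite lee_fin.
  by move=> w _; rewrite lee_fin.
by rewrite ep em -leeBrDr// addeAC apq EFinB.
Qed.

End Expectation.

(** * The iterates of DP-SGD *)

Section Iterates.
Context {R : realType} {n d m : nat} {X : Type}.
Variables (s : 'I_n -> X) (loss : 'rV[R]_d -> X -> R) (c alpha : R) (x1 : 'rV[R]_d).
Hypothesis dloss : forall i y, differentiable (fun z => loss z (s i)) y.
Hypothesis c0 : 0 < c.
Notation f := (favg loss s).

Lemma differentiable_favg y : differentiable f y.
Proof.
have -> : f = n%:R^-1 \*: (\sum_(i < n) (fun z => loss z (s i))).
  by apply/funext => z; rewrite /favg fct_sumE.
by apply: differentiableZ; apply: differentiable_sum => i; exact: dloss.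
Qed.

Lemma grad_favgD_xi y i :
  grad f y + xi loss s y i = grad (fun z => loss z (s i)) y.
Proof. by rewrite addrC subrK. Qed.

Section Measurability.
Context {dO : measure_display} {Omega : measurableType dO}.
Variables (idx : nat -> 'I_m -> Omega -> 'I_n) (Z : nat -> Omega -> 'rV[R]_d).

Definition gradient_estimate (t : nat) (w : Omega) : 'rV[R]_d :=
  let xt := dpsgd loss s c alpha x1 idx Z t w in
  m%:R^-1 *: \sum_(k < m) clip (grad f xt + xi loss s xt (idx t k w)) c.

Lemma dpsgdS t w : dpsgd loss s c alpha x1 idx Z t.+1 w =
  dpsgd loss s c alpha x1 idx Z t w - alpha *: (gradient_estimate t w + Z t w).
Proof. by []. Qed.

Lemma measurable_clip_grad (h : Omega -> 'rV[R]_d) i : measurable_vec h ->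
  measurable_vec (fun w => clip (grad f (h w) + xi loss s (h w) i) c).
Proof.
move=> mh; under [X in measurable_vec X]eq_fun do rewrite grad_favgD_xi.
by apply: measurable_clip => //; exact: measurable_grad.
Qed.

(** The random index is resolved by summing over all samples [i] the indicator of [idx t k = i]
    times the clipped gradient of sample [i]. *)
Lemma measurable_gradient_estimate t :
  (forall k i, measurable (idx t k @^-1` [set i])) ->
  measurable_vec (dpsgd loss s c alpha x1 idx Z t) ->
  measurable_vec (gradient_estimate t).
Proof.
move=> midx mx; apply: measurable_vecZ => //; apply: measurable_vec_sum => k.
pose h i w := clip (grad f (dpsgd loss s c alpha x1 idx Z t w) +
  xi loss s (dpsgd loss s c alpha x1 idx Z t w) i) c.
rewrite (_ : (fun w => _) = (fun w => \sum_i (\1_(idx t k @^-1` [set i]) w : R) *: h i w)).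
  apply: measurable_vec_sum => i; apply: measurable_vecZ.
    exact: measurable_indic.
  exact: measurable_clip_grad.
apply/funext => w; rewrite (bigD1 (idx t k w))//= big1 => [|i ik].
  by rewrite indicE mem_set//= scale1r addr0.
by rewrite indicE memNset ?scale0r//= => /esym/eqP; rewrite (negPf ik).
Qed.

Lemma measurable_dpsgd t :
  (forall r k i, (r < t)%N -> measurable (idx r k @^-1` [set i])) ->
  (forall r, (r < t)%N -> measurable_vec (Z r)) ->
  measurable_vec (dpsgd loss s c alpha x1 idx Z t).
Proof.
elim: t => [|t IH] midx mZ; first exact: measurable_vec_cst.
have mx : measurable_vec (dpsgd loss s c alpha x1 idx Z t).
  by apply: IH => r *; [apply: midx|apply: mZ]; exact: ltnW.
apply: measurable_vecB => //; apply: measurable_vecZ => //.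
apply: measurable_vecD; last exact: mZ.
by apply: measurable_gradient_estimate => // k i; exact: midx.
Qed.

(** Pairing the average with itself and bounding each [<g, clip>] by [|g| c] gives
    [|g|^2 <= |g| c]. *)
Lemma gradient_estimate_sqr_le t w : (0 < m)%N ->
  dotv (gradient_estimate t w) (gradient_estimate t w) <= c ^+ 2.
Proof.
move=> m0; set g := gradient_estimate t w.
have g0 := enorm_ge0 g.
suff : enorm g ^+ 2 <= enorm g * c.
  rewrite -sqr_enorm => H; have [->|gp] := eqVneq (enorm g) 0.
    by rewrite expr0n/= sqr_ge0.
  rewrite ler_sqr ?nnegrE ?(ltW c0)//.
  by rewrite expr2 ler_pM2l in H; rewrite // lt_def gp.
rewrite sqr_enorm {2}/g dotvZr dotv_sumr ler_pdivrMl ?ltr0n//.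
apply: (@le_trans _ _ (\sum_(k < m) enorm g * c)); last first.
  by rewrite sumr_const card_ord mulr_natl.
by apply: ler_sum => k _; apply: le_trans (dotv_clip_le _ _ c0); exact: ler_norm.
Qed.

End Measurability.

(** * Independence of the fresh noise and samples from the past *)

Section Stochastic.
Context {dO : measure_display} {Omega : measurableType dO} {T : nat}.
Variables (P : probability Omega R) (sigma : R).
Variables (idx : nat -> 'I_m -> Omega -> 'I_n) (Z : nat -> Omega -> 'rV[R]_d).
Hypothesis sigma0 : sigma != 0.
Hypothesis idx_law : forall t (k : 'I_m) (i : 'I_n), (t < T)%N ->
  measurable (idx t k @^-1` [set i]) /\ P (idx t k @^-1` [set i]) = (n%:R^-1)%:E.
Hypothesis Z_law : forall t (j : 'I_d), (t < T)%N ->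
  measurable_fun setT (fun w => Z t w 0 j) /\
  (forall B : set R, measurable B ->
     P ((fun w => Z t w 0 j) @^-1` B) = normal_prob 0 sigma B).
Hypothesis indep : mutually_independent P (rv_events idx Z (T := T)).
Notation K := ('I_T * 'I_m + 'I_T * 'I_d)%type.
Notation E := (rv_events idx Z (T := T)).
Notation x := (dpsgd loss s c alpha x1 idx Z).
Notation g := (gradient_estimate idx Z).

Lemma rv_events_measurable k : E k `<=` measurable.
Proof.
case: k => [[t k]|[t j]] _ [B mB <-] /=.
  rewrite (_ : _ @^-1` B = \bigcup_(i in B) (idx t k @^-1` [set i])).
    apply: fin_bigcup_measurable => [|i _]; first exact: finite_finset.
    by case: (idx_law k i (ltn_ord t)).
  by apply/seteqP; split=> [w Bw|w [i Bi /= ->]]//; exists (idx t k w).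
by have [mZ _] := Z_law j (ltn_ord t); rewrite -[X in measurable X]setTI; exact: mZ.
Qed.

Lemma rv_events_setI k : setI_closed (E k).
Proof.
case: k => [[t k]|[t j]] _ _ [A mA <-] [B mB <-]; rewrite -preimage_setI.
  by exists (A `&` B).
by exists (A `&` B) => //; exact: measurableI.
Qed.

Lemma rv_events_setT k : E k setT.
Proof.
by case: k => [[t k]|[t j]]; exists setT => //; exact: measurableT.
Qed.

(** The variables that determine [x t]; as iterates are indexed from 0, those of time [t] are
    excluded. *)
Definition past (t : nat) : {set K} := [set k : K | match k with
  | inl p => (p.1 < t)%N | inr p => (p.1 < t)%N end].

(** Adding the indices drawn at time [t] determines the gradient estimate as well, while [Z t] stays
    outside and hence independent. *)
Definition past_with_sample (t : nat) : {set K} := [set k : K | match k with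
  | inl p => (p.1 <= t)%N | inr p => (p.1 < t)%N end].

Notation sigma_of J := (g_sigma_algebraType (cylinders E J)).

Lemma measurable_sigma_of J (U : Omega -> R) :
  measurable_fun setT (U : sigma_of J -> R) -> measurable_fun setT U.
Proof.
move=> mU _ B mB.
suff : <<s cylinders E J >> `<=` measurable by apply; exact: mU.
apply: smallest_sub; first exact: sigma_algebra_measurable.
exact: (cylinders_measurable rv_events_measurable).
Qed.

Lemma idx_sigma_of (J : {set K}) t k i (tT : (t < T)%N) :
  inl (Ordinal tT, k) \in J ->
  measurable (idx t k @^-1` [set i] : set (sigma_of J)).
Proof.
move=> kJ; apply: sub_sigma_algebra; apply: cylinders_mem kJ _.
  exact: rv_events_setT.
by exists [set i].
Qed.

Lemma Z_sigma_of (J : {set K}) t (tT : (t < T)%N) :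
  (forall j, inr (Ordinal tT, j) \in J) ->
  measurable_vec (Z t : sigma_of J -> 'rV[R]_d).
Proof.
move=> kJ j _ B mB; rewrite setTI; apply: sub_sigma_algebra.
apply: cylinders_mem (kJ j) _; first exact: rv_events_setT.
by exists B.
Qed.

Lemma x_sigma_of (J : {set K}) t : (t <= T)%N -> past t \subset J ->
  measurable_vec (x t : sigma_of J -> 'rV[R]_d).
Proof.
move=> tT /fintype.subsetP pJ; apply: measurable_dpsgd => [r k i rt|r rt].
  apply: (@idx_sigma_of J r k i (leq_trans rt tT)); apply: pJ.
  by rewrite inE.
apply: (@Z_sigma_of J r (leq_trans rt tT)) => j; apply: pJ.
by rewrite inE.
Qed.

Lemma measurable_x t : (t <= T)%N -> measurable_vec (x t).
Proof. by move=> tT j; apply: measurable_sigma_of (x_sigma_of tT (subxx _) j). Qed.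

Lemma expectation_mul_noise t (tT : (t < T)%N) j (U : Omega -> R) :
  measurable_fun setT (U : sigma_of (past_with_sample t) -> R) ->
  P.-integrable setT (fun w => (U w ^+ 2)%:E) ->
  has_expectation P (fun w => U w * Z t w 0 j) 0.
Proof.
move=> mU iU2; have [mZ lZ] := Z_law j tT.
have iUZ : P.-integrable setT (fun w => (U w * Z t w 0 j)%:E).
  apply: integrable_mul_sqr => //; first exact: measurable_sigma_of mU.
  exact: integrable_sqr_gaussian lZ.
split=> //.
apply: (integral_indep_mul_eq0 rv_events_measurable rv_events_setI indep
  (J := past_with_sample t) (k0 := inr (Ordinal tT, j))) => //.
- by rewrite inE ltnn.
- by move=> B mB; exists B.
- exact: integrable_gaussian lZ.
- exact: integral_gaussian lZ.
Qed.

(** [V], the indicator minus its mean [1/n], is independent of the past and therefore orthogonal to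
    [U]; adding back [U / n] gives the claim. *)
Lemma expectation_mul_sample t (tT : (t < T)%N) k i (U : Omega -> R) a :
  measurable_fun setT (U : sigma_of (past t) -> R) -> has_expectation P U a ->
  has_expectation P (fun w => \1_(idx t k @^-1` [set i]) w * U w) (n%:R^-1 * a).
Proof.
move=> mU Ua; have [mi Pi] := idx_law k i tT.
pose A := idx t k @^-1` [set i].
have iA : has_expectation P (\1_A : Omega -> R) n%:R^-1.
  by split; [exact: integrable_indic|rewrite integral_indic// setIT; exact: Pi].
pose V w : R := \1_A w + - n%:R^-1.
have [iV EV] := has_expectationD iA (has_expectation_cst P (- n%:R^-1)).
have iAU := integrable_mul_indic mi Ua.1.
have hAU := has_expectation_fine iAU.
have hn := has_expectationZ (- n%:R^-1) Ua.
have hUV : has_expectation P (fun w => U w * V w) 0.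
  have iUV : P.-integrable setT (fun w => (U w * V w)%:E).
    have [+ _] := has_expectationD hAU hn; apply: eq_integrable => // w _ /=.
    by rewrite /V mulrDr (mulrC (U w) (\1_A w)) (mulrC (U w) (- _)).
  split=> //.
  apply: (integral_indep_mul_eq0 rv_events_measurable rv_events_setI indep
    (J := past t) (k0 := inl (Ordinal tT, k))) => //.
  - by rewrite inE ltnn.
  - move=> B mB; exists [set j | B ((j == i)%:R - n%:R^-1)] => //.
    apply/funext => w /=; rewrite /preimage/= /V indicE (_ : (w \in A) = (idx t k w == i))//.
    by apply/idP/eqP; rewrite inE.
  - by rewrite EV subrr.
have := has_expectationD hUV (has_expectationZ n%:R^-1 Ua); rewrite add0r.
congr (has_expectation _ _ _); apply/funext => w; rewrite /V; ring.
Qed.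

(** * Moments of the iterates and expected descent *)

Variables (G : R) (xmin : 'rV[R]_d).
Hypothesis m0 : (0 < m)%N.
Hypothesis G0 : 0 < G.
Hypothesis grad_lip : forall y z, enorm (grad f y - grad f z) <= G * enorm (y - z).
Hypothesis fmin : forall y, f xmin <= f y.

Lemma noise_second_moment t : (t < T)%N ->
  exists2 q, has_expectation P (fun w => dotv (Z t w) (Z t w)) q &
    q <= d%:R * sigma ^+ 2.
Proof.
move=> tT; have Zj j := has_expectation_fine (integrable_sqr_gaussian sigma0
  (Z_law j tT).1 (Z_law j tT).2).
exists (\sum_j fine (\int[P]_w (Z t w 0 j ^+ 2)%:E)).
  exact: has_expectation_sum Zj.
rewrite mulr_natl -[X in _ *+ X]card_ord -sumr_const; apply: ler_sum => j _.
rewrite -lee_fin -(Zj j).2.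
have [mZ lZ] := Z_law j tT.
by have := integral_sqr_gaussian_le sigma0 mZ lZ.
Qed.

(** One step at most doubles the squared distance to [x1] and adds [4 alpha^2 (c^2 + |Z t|^2)]. The
    growth in [t] is harmless: only finiteness matters. *)
Lemma integrable_dist_sqr t : (t <= T)%N ->
  P.-integrable setT (fun w => (dotv (x t w - x1) (x t w - x1))%:E).
Proof.
elim: t => [_|t IH tT].
  rewrite (_ : (fun w => _) = (fun=> 0%:E)); first by have [] := has_expectation_cst P 0.
  by apply/funext => w /=; rewrite subrr dotv0r.
have [q Zq _] := noise_second_moment tT.
have xq := has_expectation_fine (IH (ltnW tT)).
have [+ _] := has_expectationD (has_expectationZ 2 xq)
  (has_expectationZ (4 * alpha ^+ 2) (has_expectationD (has_expectation_cst P (c ^+ 2)) Zq)).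
apply: integrable_bounded.
  by apply: measurable_dotv; apply: measurable_vecB; try exact: measurable_x;
    exact: measurable_vec_cst.
move=> w; rewrite ger0_norm ?dotv_ge0// dpsgdS addrAC.
apply: (le_trans (dotv_sqrD_le _ _)); rewrite lerD2l dotvNl dotvNr opprK dotvZl dotvZr.
have := gradient_estimate_sqr_le idx Z t w m0.
have := dotv_sqrD_le (g t w) (Z t w); have := sqr_ge0 alpha; nra.
Qed.

Lemma integrable_grad_sqr t : (t <= T)%N ->
  P.-integrable setT (fun w => (dotv (grad f (x t w)) (grad f (x t w)))%:E).
Proof.
move=> tT; have xq := has_expectation_fine (integrable_dist_sqr tT).
have [+ _] := has_expectationD (has_expectation_cst P (2 * dotv (grad f x1) (grad f x1)))
  (has_expectationZ (2 * G ^+ 2) xq).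
have mg : measurable_vec (fun w => grad f (x t w)).
  by apply: measurable_grad; [exact: differentiable_favg|exact: measurable_x].
apply: integrable_bounded; first exact: measurable_dotv.
move=> w; rewrite ger0_norm ?dotv_ge0// -{1 2}(subrKC (grad f x1) (grad f (x t w))).
apply: (le_trans (dotv_sqrD_le _ _)); rewrite lerD2l -!sqr_enorm -mulrA -exprMn.
by rewrite ler_pM2l// ler_sqr ?nnegrE ?enorm_ge0 ?mulr_ge0 ?enorm_ge0 ?(ltW G0).
Qed.

(** The objective lies between [f xmin] and the quadratic upper bound of [descent_lemma] around
    [x1]. *)
Lemma integrable_objective t : (t <= T)%N ->
  P.-integrable setT (fun w => (f (x t w))%:E).
Proof.
move=> tT; have xq := has_expectation_fine (integrable_dist_sqr tT).
have [+ _] := has_expectationD (has_expectation_cst P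
   (`|f xmin| + `|f x1| + dotv (grad f x1) (grad f x1)))
  (has_expectationZ (1 + G / 2) xq).
apply: integrable_bounded.
  apply: measurable_continuous_vec; last exact: measurable_x.
  by move=> y; apply: differentiable_continuous; exact: differentiable_favg.
move=> w; set D := dotv (x t w - x1) _.
have D0 : 0 <= D := dotv_ge0 _.
have u0 := dotv_ge0 (grad f x1).
have h := descent_lemma x1 (x t w) differentiable_favg grad_lip.
have h3 := dotv_double_le (grad f x1) (x t w - x1).
rewrite -/D in h h3.
have GD : 0 <= G / 2 * D by rewrite mulr_ge0// divr_ge0// ltW.
have l1 := lerNnormlW (lexx `|f xmin|); have l2 := ler_norm (f x1).
have a1 := normr_ge0 (f xmin); have a2 := normr_ge0 (f x1).
rewrite ler_norml; apply/andP; split; last by lra.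
have := fmin (x t w); lra.
Qed.

Definition clipped_inner i y := clip_dot (grad f y) c (xi loss s y i).

(** The conditional expectation of the inner product of gradient and estimate at time [t], given
    that the iterate is [y]. *)
Definition mean_clipped_inner y := n%:R^-1 * \sum_(i < n) clipped_inner i y.

Lemma integrable_clipped_inner t i : (t <= T)%N ->
  P.-integrable setT (fun w => (clipped_inner i (x t w))%:E).
Proof.
move=> tT; have gq := has_expectation_fine (integrable_grad_sqr tT).
have [+ _] := has_expectationD gq (has_expectation_cst P (c ^+ 2)).
apply: integrable_bounded.
  apply: measurable_dotv.
    by apply: measurable_grad; [exact: differentiable_favg|exact: measurable_x].
  by apply: measurable_clip_grad; exact: measurable_x.
move=> w; apply: (le_trans (dotv_clip_le _ _ c0)); rewrite -sqr_enorm.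
have := sqr_ge0 (enorm (grad f (x t w)) - c); have := enorm_ge0 (grad f (x t w)); nra.
Qed.

Lemma expectation_mean_clipped_inner t : (t <= T)%N ->
  has_expectation P (fun w => mean_clipped_inner (x t w))
    (n%:R^-1 * \sum_(i < n) fine (\int[P]_w (clipped_inner i (x t w))%:E)).
Proof.
move=> tT; apply: has_expectationZ; apply: has_expectation_sum => i.
exact/has_expectation_fine/integrable_clipped_inner.
Qed.

(** The inner product is a double sum, over draws [k] and samples [i], of an indicator times
    [clipped_inner i]. Each term factors by [expectation_mul_sample], and the [m] equal draws cancel
    [1/m]. *)
Lemma expectation_grad_estimate t q : (t < T)%N ->
  has_expectation P (fun w => mean_clipped_inner (x t w)) q ->
  has_expectation P (fun w => dotv (grad f (x t w)) (g t w)) q.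
Proof.
move=> tT hq.
rewrite (has_expectation_unique hq (expectation_mean_clipped_inner (ltnW tT))).
have mphi i : measurable_fun setT
    ((fun w => clipped_inner i (x t w)) : sigma_of (past t) -> R).
  have mx := x_sigma_of (ltnW tT) (subxx (past t)).
  apply: measurable_dotv.
    by apply: measurable_grad => //; exact: differentiable_favg.
  exact: measurable_clip_grad.
have hk k i := expectation_mul_sample tT k i (mphi i)
  (has_expectation_fine (integrable_clipped_inner i (ltnW tT))).
have := has_expectationZ m%:R^-1 (has_expectation_sum (index_enum 'I_m)
  (fun k => has_expectation_sum (index_enum 'I_n) (hk k))).
have mn0 : m%:R != 0 :> R by rewrite pnatr_eq0 -lt0n.
rewrite sumr_const card_ord -[X in _ * X]mulr_natl mulKf// -mulr_sumr.
congr (has_expectation _ _ _); apply/funext => w.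
rewrite /gradient_estimate dotvZr dotv_sumr; congr (_ * _); apply: eq_bigr => k _.
rewrite (bigD1 (idx t k w))//= big1 => [|i ik].
  by rewrite indicE mem_set//= mul1r addr0.
by rewrite indicE memNset ?mul0r//= => /esym/eqP; rewrite (negPf ik).
Qed.

Lemma expectation_dotv_noise t (u : Omega -> 'rV[R]_d) (tT : (t < T)%N) :
  measurable_vec (u : sigma_of (past_with_sample t) -> 'rV[R]_d) ->
  P.-integrable setT (fun w => (dotv (u w) (u w))%:E) ->
  has_expectation P (fun w => dotv (u w) (Z t w)) 0.
Proof.
move=> mu iu.
have : has_expectation P (fun w => \sum_j u w 0 j * Z t w 0 j) (\sum_(j < d) 0).
  apply: has_expectation_sum => j; apply: (expectation_mul_noise tT); first exact: mu.
  apply: (integrable_bounded _ _ iu).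
    by apply: measurable_funX; exact: measurable_sigma_of (mu j).
  by move=> w; rewrite ger0_norm ?sqr_ge0// sqr_coord_le_dotv.
by rewrite big1.
Qed.

(** Expanding the square leaves two terms linear in [Z t], paired with the gradient and with the
    estimate. Both factors are functions of [past_with_sample t], so both terms vanish in
    expectation. *)
Lemma one_step_descent t a b q : (t < T)%N ->
  has_expectation P (fun w => f (x t w)) a ->
  has_expectation P (fun w => f (x t.+1 w)) b ->
  has_expectation P (fun w => mean_clipped_inner (x t w)) q ->
  b <= a - alpha * q + G * alpha ^+ 2 / 2 * (c ^+ 2 + d%:R * sigma ^+ 2).
Proof.
move=> tT ha hb hq.
have pp : past t \subset past_with_sample t.
  apply/fintype.subsetP => -[p|p]; rewrite !inE//; exact: ltnW.
have mx := x_sigma_of (ltnW tT) pp.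
have mgr : measurable_vec
    ((fun w => grad f (x t w)) : sigma_of (past_with_sample t) -> 'rV[R]_d).
  by apply: measurable_grad => //; exact: differentiable_favg.
have mg : measurable_vec (g t : sigma_of (past_with_sample t) -> 'rV[R]_d).
  apply: measurable_gradient_estimate => // k i.
  by apply: (@idx_sigma_of _ t k i tT); rewrite inE/=.
have h1 := expectation_grad_estimate tT hq.
have h2 := expectation_dotv_noise tT mgr (integrable_grad_sqr (ltnW tT)).
have ig : P.-integrable setT (fun w => (dotv (g t w) (g t w))%:E).
  have [+ _] := has_expectation_cst P (c ^+ 2); apply: integrable_bounded.
    by apply: measurable_dotv => j; exact: measurable_sigma_of (mg j).
  by move=> w; rewrite ger0_norm ?dotv_ge0// gradient_estimate_sqr_le.
have h3 := expectation_dotv_noise tT mg ig.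
have [z hz zle] := noise_second_moment tT.
have GA : 0 <= G * alpha ^+ 2 / 2 by rewrite divr_ge0// mulr_ge0 ?sqr_ge0// ltW.
have H := has_expectationD (has_expectationD (has_expectationD
  (has_expectationD ha (has_expectationZ (- alpha) h1)) (has_expectationZ (- alpha) h2))
  (has_expectationZ (G * alpha ^+ 2) h3))
  (has_expectationZ (G * alpha ^+ 2 / 2)
    (has_expectationD (has_expectation_cst P (c ^+ 2)) hz)).
apply: (le_trans (has_expectation_le hb H _)).
  move=> w; have := descent_lemma (x t w) (x t.+1 w) differentiable_favg grad_lip.
  have -> : x t.+1 w - x t w = - (alpha *: (g t w + Z t w)).
    by rewrite dpsgdS addrAC subrr add0r.
  have := ler_wpM2l GA (gradient_estimate_sqr_le idx Z t w m0).
  move: (g t w) (Z t w) (grad f (x t w)) => u v h gle.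
  rewrite !dotvNr !dotvNl opprK !dotvZr !dotvZl !dotvDr !dotvDl (dotvC v u); lra.
have := ler_wpM2l GA zle; lra.
Qed.

Lemma descent_sum (q : nat -> R) :
  (forall t, (t < T)%N -> has_expectation P (fun w => mean_clipped_inner (x t w)) (q t)) ->
  alpha * \sum_(t < T) q t <= f x1 - f xmin +
    T%:R * (G * alpha ^+ 2 / 2 * (c ^+ 2 + d%:R * sigma ^+ 2)).
Proof.
move=> hq; set C := G * alpha ^+ 2 / 2 * _.
have hf t : (t <= T)%N -> has_expectation P (fun w => f (x t w))
    (fine (\int[P]_w (f (x t w))%:E)).
  by move=> tT; exact/has_expectation_fine/integrable_objective.
set e := fun t => fine (\int[P]_w (f (x t w))%:E).
have H N : (N <= T)%N -> alpha * \sum_(t < N) q t <= f x1 - e N + N%:R * C.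
  elim: N => [_|N IH NT].
    have e0 := has_expectation_unique (hf 0 (leq0n _)) (has_expectation_cst P (f x1)).
    by rewrite big_ord0 mulr0 mul0r addr0 -e0 subrr.
  have := one_step_descent NT (hf _ (ltnW NT)) (hf _ NT) (hq _ NT).
  have := IH (ltnW NT); rewrite -/(e N) -/(e N.+1) -/C.
  by rewrite big_ord_recr/= mulrDr -(natr1 N) mulrDl mul1r; lra.
apply: (le_trans (H T (leqnn T))); rewrite lerD2r lerD2l lerN2.
by apply: has_expectation_le (has_expectation_cst P (f xmin)) (hf T (leqnn T)) _.
Qed.

End Stochastic.
End Iterates.

(** By [descent_lemma] a step [- G^-1 *: v] lowers [F] by at least [|v|^2 / (2 G)], which minimality
    forbids unless [v = 0]. It serves the degenerate case [Df = 0] of the theorem. *)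
Lemma grad_argmin_eq0 (R : realType) (d : nat) (F : 'rV[R]_d -> R) (G : R) x :
  0 < G -> (forall z, differentiable F z) ->
  (forall z z', enorm (grad F z - grad F z') <= G * enorm (z - z')) ->
  (forall y, F x <= F y) -> grad F x = 0.
Proof.
move=> G0 dF GF Fx; apply/eqP; rewrite -dotv_eq0 eq_le dotv_ge0 andbT.
set v := grad F x; have := descent_lemma x (x - G^-1 *: v) dF GF.
have -> : x - G^-1 *: v - x = - (G^-1 *: v) by rewrite addrAC subrr add0r.
rewrite !dotvNr !dotvNl opprK !dotvZr !dotvZl -/v => /(le_trans (Fx _)).
have -> : G / 2 * (G^-1 * (G^-1 * dotv v v)) = G^-1 * dotv v v / 2.
  by field; rewrite gt_eqF.
move=> H; have : G^-1 * dotv v v <= 0 by lra.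
by rewrite pmulr_rle0// invr_gt0.
Qed.

Theorem theorem5 (R : realType) :
  exists u v : R, 0 < u /\ 0 < v /\
  forall (n d m T : nat) (X : Type) (s : 'I_n -> X) (loss : 'rV[R]_d -> X -> R)
    (G Df c eps delta sigma alpha : R) (x1 : 'rV[R]_d)
    (dO : measure_display) (Omega : measurableType dO) (P : probability Omega R)
    (idx : nat -> 'I_m -> Omega -> 'I_n) (Z : nat -> Omega -> 'rV[R]_d)
    (ptil : nat -> 'rV[R]_d -> probability (BorelRd R d) R),
  let f := favg loss s in
  let x := dpsgd loss s c alpha x1 idx Z in
  (* setting *)
  (0 < d)%N -> (0 < m)%N -> (m <= n)%N ->
  (forall (i : 'I_n) (y : 'rV[R]_d), differentiable (fun z => loss z (s i)) y) ->
  0 < G ->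
  (forall y z, enorm (grad f y - grad f z) <= G * enorm (y - z)) ->
  (exists xstar, (forall y, f xstar <= f y) /\ f x1 - f xstar <= Df) ->
  0 < c -> 0 < eps -> 0 < delta < 1 ->
  (* parameter choices *)
  eps <= u * (m%:R ^+ 2 / n%:R ^+ 2) * T%:R ->
  T%:R = n%:R ^+ 2 * eps ^+ 2 / (d%:R * ln (delta^-1)) ->
  0 <= sigma ->
  sigma ^+ 2 = v * (c ^+ 2 * T%:R * ln (delta^-1)) / (n%:R ^+ 2 * eps ^+ 2) ->
  alpha = Num.sqrt (Df * d%:R * ln (delta^-1)) / (n%:R * eps * c * Num.sqrt G) ->
  (* randomness: S_t = m i.i.d. uniform indices (sampling with replacement),
     Z_t ~ N(0, sigma^2 I_d), all independent *)
  (forall t (k : 'I_m) (i : 'I_n), (t < T)%N ->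
     measurable (idx t k @^-1` [set i]) /\
     P (idx t k @^-1` [set i]) = (n%:R^-1)%:E) ->
  (forall t (j : 'I_d), (t < T)%N ->
     measurable_fun setT (fun w => Z t w 0 j) /\
     (forall B : set R, measurable B ->
        P ((fun w => Z t w 0 j) @^-1` B) = normal_prob 0 sigma B)) ->
  mutually_independent P (rv_events idx Z (T := T)) ->
  (* the symmetric comparison distributions *)
  (forall t y, symmetric_distr (ptil t y)) ->
  (* the expectations below are of measurable functions *)
  (forall t, (t < T)%N -> measurable_fun setT (fun w =>
      (ptil t (x t w) [set z : 'rV[R]_d | (enorm z < c / 4)%R] *
       (hc c (enorm (grad f (x t w))))%:E)%E)) ->
  (forall t, (t < T)%N -> measurable_fun setT (fun w =>
      wasserstein (grad f (x t w)) c (ptil t (x t w))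
                  (empirical (xi loss s (x t w))))) ->
  (((T%:R)^-1)%:E * \sum_(t < T)
      \int[P]_w (ptil t (x t w) [set z : 'rV[R]_d | (enorm z < c / 4)%R] *
                 (hc c (enorm (grad f (x t w))))%:E)
   <= ((v / 2 + 3 / 2) * c * Num.sqrt (Df * G * d%:R * ln (delta^-1))
        / (n%:R * eps))%:E
      + ((T%:R)^-1)%:E * \sum_(t < T)
          \int[P]_w wasserstein (grad f (x t w)) c (ptil t (x t w))
                                (empirical (xi loss s (x t w))))%E.
Proof.
exists 1, 1; split=> //; split=> //.
move=> n d m T X s loss G Df c eps delta sigma alpha x1 dO Omega P idx Z ptil f x.
move=> d0 m0 mn dloss G0 lip [xmin [fmin fDf]] c0 eps0 /andP[delta0 delta1] _ TE.
move=> sigma_ge0 sigmaE alphaE idxP ZP indep sym mL mW.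
have n0 : (0 < n)%N := leq_trans m0 mn.
set L := ln delta^-1 in TE sigmaE alphaE *.
have L0 : 0 < L by rewrite ln_gt0// invf_gt1.
have dR : 0 < d%:R :> R by rewrite ltr0n.
have nR : 0 < n%:R :> R by rewrite ltr0n.
have TR : 0 < T%:R :> R.
  by rewrite TE divr_gt0 ?mulr_gt0 ?exprn_gt0.
have sigma_d : d%:R * sigma ^+ 2 = c ^+ 2.
  rewrite sigmaE TE; field.
  by rewrite !gt_eqF.
have sigma0 : sigma != 0.
  apply: contraTneq (exprn_gt0 2 c0) => s0.
  by rewrite -sigma_d s0 expr0n mulr0 ltxx.
have Df0 : 0 <= Df by apply: le_trans fDf; rewrite subr_ge0 fmin.
pose W t w := wasserstein (grad f (x t w)) c (ptil t (x t w)) (empirical (xi loss s (x t w))).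
pose H t w := (ptil t (x t w) [set z : 'rV[R]_d | (enorm z < c / 4)%R] *
  (hc c (enorm (grad f (x t w))))%:E)%E.
have W0 t w : (0 <= W t w)%E by exact: wasserstein_ge0.
have H0 t w : (0 <= H t w)%E by rewrite mule_ge0// lee_fin hc_ge0 ?enorm_ge0 ?ltW.
have TI0 : (0 <= (T%:R^-1)%:E :> \bar R)%E by rewrite lee_fin invr_ge0 ltW.
have rhs0 : 0 <= (1 / 2 + 3 / 2) * c * Num.sqrt (Df * G * d%:R * L) / (n%:R * eps).
  rewrite divr_ge0 ?mulr_ge0 ?sqrtr_ge0 ?(ltW c0) ?(ltW eps0)//; lra.
(* If [Df = 0] then [alpha = 0] and the telescoped bound cannot be divided by it. But then the
   iterates never leave [x1], which is a minimiser, so the left-hand side is zero. *)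
have [Df_eq0|Df_neq0] := eqVneq Df 0.
  have alpha0 : alpha = 0 by rewrite alphaE Df_eq0 !mul0r sqrtr0 mul0r.
  have xE t w : x t w = x1.
    by elim: t => // t IH; rewrite /x dpsgdS -/x IH alpha0 scale0r subr0.
  have g0 : grad f x1 = 0.
    apply: (grad_argmin_eq0 G0 (differentiable_favg dloss) lip) => y.
    by apply: le_trans (fmin y); rewrite -subr_le0 -Df_eq0.
  rewrite big1 => [|t _]; last first.
    apply: integral0_eq => w _.
    by rewrite xE g0 enorm0 /hc expr0n/= mulr0 minxx mule0.
  rewrite mule0 adde_ge0 ?lee_fin// mule_ge0// sume_ge0// => t _.
  by apply: integral_ge0 => w _; exact: W0.
have Df_gt0 : 0 < Df by rewrite lt_def Df_neq0.
have alpha0 : 0 < alpha.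
  by rewrite alphaE divr_gt0 ?sqrtr_gt0 ?mulr_gt0// sqrtr_gt0.
pose q t := n%:R^-1 * \sum_(i < n) fine (\int[P]_w (clipped_inner s loss c i (x t w))%:E).
have hq t : (t < T)%N ->
    has_expectation P (fun w => mean_clipped_inner s loss c (x t w)) (q t).
  move=> tT; exact: (expectation_mean_clipped_inner alpha x1 dloss c0 sigma0
    idxP ZP m0 G0 lip (ltnW tT)).
have HW t : (t < T)%N -> (\int[P]_w H t w <= (q t)%:E + \int[P]_w W t w)%E.
  move=> tT; apply: (integral_le_add (hq t tT)) => //; [exact: mL|exact: mW|].
  by move=> w; exact: wasserstein_clip_bound.
have sumq := descent_sum dloss c0 sigma0 idxP ZP indep m0 G0 lip fmin hq.
(* The choice of [alpha] balances the telescoped bound: the initial gap is at most [Df], and the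
   smoothness term is [T G alpha^2 c^2 = Df]. Their sum [2 Df] accounts for the constant
   [1/2 + 3/2]. *)
have bound : T%:R^-1 * \sum_(t < T) q t <=
    (1 / 2 + 3 / 2) * c * Num.sqrt (Df * G * d%:R * L) / (n%:R * eps).
  rewrite -(ler_pM2l alpha0) mulrCA ler_pdivrMl//.
  apply: (le_trans sumq).
  (* With the square roots as atoms [r] and [h], the identities become rational and [field]
     applies. *)
  pose r := Num.sqrt (Df * d%:R * L); pose h := Num.sqrt G.
  have r0 : 0 < r by rewrite sqrtr_gt0 !mulr_gt0.
  have h0 : 0 < h by rewrite sqrtr_gt0.
  have r2 : r ^+ 2 = Df * d%:R * L by rewrite sqr_sqrtr// !mulr_ge0// ltW.
  have h2 : h ^+ 2 = G by rewrite sqr_sqrtr// ltW.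
  have -> : Num.sqrt (Df * G * d%:R * L) = r * h.
    by rewrite -sqrtrM ?mulr_ge0 ?(ltW dR) ?(ltW L0)//; congr Num.sqrt; ring.
  rewrite -/r -/h in alphaE.
  have -> : T%:R * (alpha * ((1 / 2 + 3 / 2) * c * (r * h) / (n%:R * eps))) = 2 * Df.
    have -> : 2 * Df = 2 * r ^+ 2 / (d%:R * L) by rewrite r2; field; rewrite !gt_eqF.
    by rewrite TE alphaE; field; rewrite !gt_eqF.
  have -> : T%:R * (G * alpha ^+ 2 / 2 * (c ^+ 2 + d%:R * sigma ^+ 2)) = Df.
    have -> : Df = r ^+ 2 / (d%:R * L) by rewrite r2; field; rewrite !gt_eqF.
    by rewrite sigma_d TE alphaE -h2; field; rewrite !gt_eqF.
  by move: fDf; rewrite /f; lra.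
apply: (@le_trans _ _ ((T%:R^-1)%:E * (\sum_(t < T) ((q t)%:E + \int[P]_w W t w)))%E).
  by rewrite lee_wpmul2l// lee_sum// => t _; exact: HW.
rewrite big_split/= sumEFin muleDr//.
by rewrite leeD2r// -EFinM lee_fin.
Qed.
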